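(* $\mathrm{SSCM}(3,1;4;3,3)=\mathrm{RE}$. That is, a language is recursively enumerable if and only if it is generated by a simple semi-conditional matrix grammar of degree $(3,1)$ with at most $4$ nonterminals, at most $3$ conditional matrices, and all matrices of length at most $3$.
   Context: A semi-conditional matrix (SCM) grammar is a quadruple $G=(V,T,M,S)$ with the following components. - $V$ is a finite alphabet and $T\subsetneq V$ is the set of terminals. - $N=V\setminus T$ is the set of nonterminals and $S\in N$ is the start symbol. - $M$ is a finite set of matrices of the form $r=[(A_1\to x_1),\dots,(A_\ell\to x_\ell),P,F]$, where $\ell\ge 1$, $A_k\in N$, $x_k\in V^*$, and $P,F\in V^+\cup\{\emptyset\}$. Here $\emptyset\notin V$ is a special symbol meaning that the condition is absent, and $|\emptyset|=0$. The number $\ell$ is the length of $r$. A matrix is classified as follows: - unconditional if $P=F=\emptyset$, and conditional otherwise; - simple if at least one of $P,F$ equals $\emptyset$, and non-simple if both $P\neq\emptyset$ and $F\neq\emptyset$. For $x,y\in V^*$ we write $x\Rightarrow_r y$ iff all of the following hold: 1. if $P\neq\emptyset$ then $P$ is a subword (factor) of $x$; 2. if $F\neq\emptyset$ then $F$ is not a subword of $x$; 3. there are words $x=y_0,y_1,\dots,y_\ell=y$ such that $y_k$ is obtained from $y_{k-1}$ by replacing one occurrence of $A_k$ by $x_k$. $\Rightarrow_G$ is the union of the relations $\Rightarrow_r$ over $r\in M$, and $L(G)=\{y\in T^*: S\Rightarrow_G^* y\}$. $G$ has degree $(i,j)$ if every matrix satisfies $|P|\le i$ and $|F|\le j$. $\mathrm{SCM}(i,j;n;m,\ell,s)$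 denotes the family of languages $L(G)$ of SCM grammars $G$ that satisfy all of the following: - $G$ has degree $(i,j)$; - $|N|\le n$; - $G$ has at most $m$ conditional matrices; - every matrix of $G$ has length at most $\ell$; - $G$ has at most $s$ non-simple matrices. A $*$ in a parameter position means that parameter is unbounded. $\mathrm{SSCM}(i,j;n;m,\ell)=\mathrm{SCM}(i,j;n;m,\ell,0)$, i.e., all matrices are simple. $\mathrm{RE}$ is the class of recursively enumerable languages. *)

(* Defs.v *)
From Stdlib Require Import Relations.
From Stdlib Require List.
From mathcomp Require Import all_boot.
Set Implicit Arguments. Unset Strict Implicit. Unset Printing Implicit Defensive.

Record psgrammar := PSG {
  psN : seq nat;
  psT : seq nat;
  psP : seq (seq nat * seq nat);
  psS : nat
}.

Definition psg_wf (G : psgrammar) : Prop :=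
  [/\ (forall a, a \in psN G -> a \notin psT G),
      psS G \in psN G &
      (forall p, List.In p (psP G) ->
         [/\ has (fun a => a \in psN G) p.1,
             all (fun a => (a \in psN G) || (a \in psT G)) p.1 &
             all (fun a => (a \in psN G) || (a \in psT G)) p.2])].

Definition psg_step (G : psgrammar) (x y : seq nat) : Prop :=
  exists p, List.In p (psP G) /\
    exists x1 x2, x = x1 ++ p.1 ++ x2 /\ y = x1 ++ p.2 ++ x2.

Definition psg_lang (G : psgrammar) (w : seq nat) : Prop :=
  all (fun a => a \in psT G) w /\
  clos_refl_trans (seq nat) (psg_step G) [:: psS G] w.

Definition is_RE (L : seq nat -> Prop) : Prop :=
  exists G : psgrammar, psg_wf G /\ forall w, L w <-> psg_lang G w.

(* A condition is [None] (the symbol \emptyset) or [Some w] with w in V^+. *)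

Record scm_matrix := SCMMatrix {
  mrules : seq (nat * seq nat);
  mperm : option (seq nat);
  mforb : option (seq nat)
}.

Record scm_grammar := SCMG {
  gV : seq nat;
  gT : seq nat;
  gM : seq scm_matrix;
  gS : nat
}.

Definition is_nonterm (G : scm_grammar) (a : nat) : bool :=
  (a \in gV G) && (a \notin gT G).

Definition cond_ok (G : scm_grammar) (c : option (seq nat)) : bool :=
  match c with
  | None => true
  | Some w => (w != [::]) && all (fun a => a \in gV G) w
  end.

Definition scm_wf (G : scm_grammar) : Prop :=
  [/\ {subset gT G <= gV G},
      (exists a, is_nonterm G a),
      is_nonterm G (gS G) &
      (forall r, List.In r (gM G) ->
         [/\ mrules r != [::],
             all (fun p => is_nonterm G p.1 && all (fun a => a \in gV G) p.2)
                 (mrules r),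
             cond_ok G (mperm r) & cond_ok G (mforb r)])].

Definition num_nonterms (G : scm_grammar) : nat :=
  size (undup [seq a <- gV G | a \notin gT G]).

Definition cond_len (c : option (seq nat)) : nat :=
  match c with None => 0 | Some w => size w end.

Definition is_conditional (r : scm_matrix) : bool :=
  (mperm r != None) || (mforb r != None).

Definition is_simple (r : scm_matrix) : bool :=
  (mperm r == None) || (mforb r == None).

Definition replace_one (A : nat) (x u v : seq nat) : Prop :=
  exists u1 u2, u = u1 ++ A :: u2 /\ v = u1 ++ x ++ u2.

Fixpoint apply_rules (rs : seq (nat * seq nat)) (u v : seq nat) : Prop :=
  match rs with
  | [::] => u = v
  | (A, x) :: rs' => exists w, replace_one A x u w /\ apply_rules rs' w v
  end.

Definition mstep (r : scm_matrix) (u v : seq nat) : Prop :=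
  [/\ (match mperm r with None => True | Some p => infix p u end),
      (match mforb r with None => True | Some f => ~~ infix f u end) &
      apply_rules (mrules r) u v].

Definition scm_step (G : scm_grammar) (u v : seq nat) : Prop :=
  exists r, List.In r (gM G) /\ mstep r u v.

Definition scm_lang (G : scm_grammar) (w : seq nat) : Prop :=
  all (fun a => a \in gT G) w /\
  clos_refl_trans (seq nat) (scm_step G) [:: gS G] w.

Definition scm_params (G : scm_grammar) (i j n m l s : nat) : Prop :=
  [/\ (forall r, List.In r (gM G) ->
         cond_len (mperm r) <= i /\ cond_len (mforb r) <= j),
      num_nonterms G <= n,
      count is_conditional (gM G) <= m,
      (forall r, List.In r (gM G) -> size (mrules r) <= l) &
      count (fun r => ~~ is_simple r) (gM G) <= s].

Definition in_SCM (i j n m l s : nat) (L : seq nat -> Prop) : Prop :=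
  exists G : scm_grammar, scm_wf G /\ scm_params G i j n m l s /\
    forall w, L w <-> scm_lang G w.

Definition in_SSCM (i j n m l : nat) (L : seq nat -> Prop) : Prop :=
  in_SCM i j n m l 0 L.

(* Main.v *)
Require Import Defs.
From Stdlib Require Import Relations.
From Stdlib Require List.
From mathcomp Require Import all_boot.
From mathcomp Require Import zify.
Set Implicit Arguments. Unset Strict Implicit. Unset Printing Implicit Defensive.

(** A phrase structure derivation of w is read backwards as a string of blocks
    #w#x_1#x_2#...#S#, each sentential form being derivable from the next one.
    Such a string exists iff #w u_1...u_k = v_1...v_k for some sequence of pairs
    (u_i, v_i) among (#, #), (#, #S#), (c, c) and the pairs (lhs, rhs).

    The matrix grammar codes the letter i by A^(i+1) B^(i+1).  It produces w and
    the mirrored code of #w around the center SSC, then the codes of the v_i on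
    the left (with A and B exchanged) and of the u_i on the right around the
    center CCC, and finally cancels opposite letters around the center S.  A
    cancelled pair A, B is first renamed to C, C (only when no C is present) and
    then erased only if CSC is a factor, so the two letters were the neighbours
    of S.  The last S is erased when no C is present.  A rule that needs two S or three C cannot be applied in a later phase.
    All matrices but the first one preserve #A - #B, which is -1 for the start
    word B and 0 for terminal words, so the first one is used exactly once.

    Conversely, a phrase structure grammar simulates a matrix grammar by a head
    that moves between two end markers and stores the rules still to be applied. *)

Notation star R := (clos_refl_trans (seq nat) R).

(** * Induction along derivations and unique factorization of words *)

Lemma star_ind_left (R : seq nat -> seq nat -> Prop) (P : seq nat -> Prop) z :
  P z -> (forall x y, R x y -> star R y z -> P y -> P x) ->
  forall x, star R x z -> P x.
Proof.
move=> Pz IH x0 xz; elim: {xz} (clos_rt_rt1n _ _ _ _ xz) Pz IH => // x y w xy yw IHw Pw IH.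
by apply: (IH _ _ xy); [apply: clos_rt1n_rt | apply: IHw].
Qed.

Lemma star_ind_right (R : seq nat -> seq nat -> Prop) (P : seq nat -> Prop) x :
  P x -> (forall y z, star R x y -> R y z -> P y -> P z) ->
  forall z, star R x z -> P z.
Proof.
move=> Px IH z0 xz; elim: {xz} (clos_rt_rtn1 _ _ _ _ xz) => // y z yz xy; apply: IH yz.
exact: clos_rtn1_rt.
Qed.

Lemma In_mem (T : eqType) (x : T) (s : seq T) : List.In x s <-> x \in s.
Proof.
elim: s => [|y s IH] //=; rewrite inE; split.
  by case=> [->|/IH ->]; rewrite ?eqxx ?orbT.
by case/orP=> [/eqP->|/IH]; [left | right].
Qed.

Lemma In_cat (T : Type) (x : T) s t :
  List.In x (s ++ t) <-> List.In x s \/ List.In x t.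
Proof. exact: List.in_app_iff. Qed.

Lemma In_map (T U : Type) (f : T -> U) y s :
  List.In y (map f s) <-> exists2 x, List.In x s & y = f x.
Proof.
elim: s => [|a s IH] /=; first by split=> // -[].
split; first by case=> [<-|/IH [x xs ->]]; [exists a | exists x]; auto.
by case=> x [->|xs] E; [left | right; apply/IH; exists x].
Qed.

Lemma cat_cons_split (T : Type) (a : T) u1 u2 p q :
  u1 ++ a :: u2 = p ++ q ->
  (exists p2, p = u1 ++ a :: p2 /\ u2 = p2 ++ q) \/
  (exists q1, q = q1 ++ a :: u2 /\ u1 = p ++ q1).
Proof.
elim: p u1 => [|b p IH] [|c u1] /=.
- by move=> <-; right; exists [::].
- by move=> <-; right; exists (c :: u1).
- by case=> -> ->; left; exists p.
- case=> -> /IH [[p2 [-> ->]]|[q1 [-> ->]]]; first by left; exists p2.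
  by right; exists q1.
Qed.

(** On the right-hand side [b] is the only letter satisfying [P], so the two marked positions
    coincide. A predicate in place of a fixed letter covers the case where [a] and [b] are not yet
    known to be equal. *)
Lemma cat_cons_uniq (T : eqType) (a b : T) (P : pred T) u1 u2 p q :
  P a -> P b -> ~~ has P p -> ~~ has P q ->
  u1 ++ a :: u2 = p ++ b :: q -> [/\ u1 = p, a = b & u2 = q].
Proof.
move=> Pa Pb Pp Pq H; have [[p2 [E _]]|[q1 [E1 E]]] := cat_cons_split H.
  by rewrite E has_cat /= Pa orbT in Pp.
case: q1 E1 E => [|c q1] /= [-> E] Eu; first by rewrite Eu cats0 E.
by rewrite E has_cat /= Pa orbT in Pq.
Qed.

Lemma cat_cons_first (T : eqType) (a : T) u1 u2 p q :
  a \notin u1 -> a \notin p -> u1 ++ a :: u2 = p ++ a :: q -> u1 = p /\ u2 = q.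
Proof.
move=> au ap H; have [[p2 [E _]]|[q1 [E1 E]]] := cat_cons_split H.
  by rewrite E mem_cat mem_head orbT in ap.
case: q1 E1 E => [|c q1] /= [] => [->|Ec _] E; first by rewrite E cats0.
by rewrite E -Ec mem_cat mem_head orbT in au.
Qed.

Definition fresh (s : seq nat) := (\max_(a <- s) a).+1.

Lemma fresh_gt s a : a \in s -> a < fresh s.
Proof. by move=> sa; rewrite ltnS (big_rem a) //= leq_maxl. Qed.

Lemma psg_step_cat G l r x y :
  psg_step G x y -> psg_step G (l ++ x ++ r) (l ++ y ++ r).
Proof.
move=> [p [Gp [x1 [x2 [-> ->]]]]]; exists p; split=> //.
by exists (l ++ x1), (x2 ++ r); rewrite -!catA.
Qed.

Lemma psg_star_cat G l r x y :
  star (psg_step G) x y -> star (psg_step G) (l ++ x ++ r) (l ++ y ++ r).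
Proof.
elim=> [{}x {}y xy|{}x|{}x {}y z _ IH1 _ IH2].
- by apply: rt_step; apply: psg_step_cat.
- exact: rt_refl.
- exact: rt_trans IH1 IH2.
Qed.

Lemma psg_star_catb G x x' y y' :
  star (psg_step G) x x' -> star (psg_step G) y y' ->
  star (psg_step G) (x ++ y) (x' ++ y').
Proof.
move=> /(psg_star_cat [::] y) xx' /(psg_star_cat x' [::]).
by rewrite !cats0 => yy'; apply: rt_trans yy'.
Qed.

Notation pairs := (seq (seq nat * seq nat)).

Definition tops (ps : pairs) := flatten [seq p.1 | p <- ps].
Definition bots (ps : pairs) := flatten [seq p.2 | p <- ps].

Lemma tops_cat ps qs : tops (ps ++ qs) = tops ps ++ tops qs.
Proof. by rewrite /tops map_cat flatten_cat. Qed.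

(** * Correspondence problem of a phrase structure grammar *)

Section Correspondence.

Variable G : psgrammar.
Hypothesis Gwf : psg_wf G.

Definition alphabet := psN G ++ psT G.
Definition hash := fresh alphabet.
Definition block_pair : seq nat * seq nat := ([:: hash], [:: hash]).
Definition last_pair : seq nat * seq nat := ([:: hash], [:: hash; psS G; hash]).
Definition inner_pairs : pairs := [seq ([:: c], [:: c]) | c <- alphabet] ++ psP G.
Definition corr_pairs : pairs := [:: block_pair, last_pair & inner_pairs].

Lemma hash_alphabet : hash \notin alphabet.
Proof. by apply/negP => /fresh_gt; rewrite ltnn. Qed.

Lemma psP_alphabet p : p \in psP G ->
  {subset p.1 <= alphabet} /\ {subset p.2 <= alphabet}.
Proof.
case: Gwf => _ _ wf /In_mem /wf [_ /allP h1 /allP h2].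
by split=> a; rewrite mem_cat => ?; [apply: h1 | apply: h2].
Qed.

Lemma psS_alphabet : psS G \in alphabet.
Proof. by case: Gwf => _ h _; rewrite mem_cat h. Qed.

Lemma inner_pairP p : p \in inner_pairs ->
  [/\ star (psg_step G) p.1 p.2, hash \notin p.1 & hash \notin p.2].
Proof.
have /negP nh := hash_alphabet.
rewrite mem_cat => /orP [/mapP [c Ac ->]|Pp] /=.
  split; first exact: rt_refl.
    by rewrite inE; apply/eqP => hc; apply: nh; rewrite hc.
  by rewrite inE; apply/eqP => hc; apply: nh; rewrite hc.
have [h1 h2] := psP_alphabet Pp.
split; [| by apply/negP => /h1 /nh | by apply/negP => /h2 /nh].
apply: rt_step; exists p; split; first exact/In_mem.
by exists [::], [::]; rewrite !cats0.
Qed.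

Lemma inner_corr ps : {subset ps <= inner_pairs} ->
  [/\ star (psg_step G) (tops ps) (bots ps),
      hash \notin tops ps & hash \notin bots ps].
Proof.
elim: ps => [|p ps IH] sub; first by split=> //; apply: rt_refl.
have [|h1 h2 h3] := IH; first by move=> q qs; apply: sub; rewrite inE qs orbT.
have [k1 k2 k3] := inner_pairP (sub p (mem_head _ _)).
split; first exact: psg_star_catb.
- by rewrite /tops /= mem_cat negb_or k2.
- by rewrite /bots /= mem_cat negb_or k3.
Qed.

(** Inner pairs contain no #, so the first # of the bottom word starts the bottom of the first outer
    pair. *)
Lemma corr_first_block ps w r : {subset ps <= corr_pairs} -> hash \notin w ->
  w ++ hash :: r = bots ps ->
  exists ps1 p ps2, [/\ ps = ps1 ++ p :: ps2, {subset ps1 <= inner_pairs},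
    p = block_pair \/ p = last_pair, w = bots ps1 & hash :: r = bots (p :: ps2)].
Proof.
elim: ps w => [|p ps IH] w sub hw; first by case: w {hw}.
have [|outer Ew] := boolP (p \in inner_pairs).
  move=> pin Ew; have [_ _ h2] := inner_pairP pin.
  have Ew' : w ++ hash :: r = p.2 ++ bots ps by [].
  have [[p2 [E _]]|[q1 [E1 E2]]] := cat_cons_split Ew'.
    by rewrite E mem_cat inE eqxx orbT in h2.
  have [||ps1 [q [ps2 [-> s1 Eq E3 E4]]]] := IH q1 _ _ (esym E1).
  - by move=> x xs; apply: sub; rewrite inE xs orbT.
  - by apply: contra hw; rewrite E2 mem_cat orbC => ->.
  exists (p :: ps1), q, ps2; split=> //; last by rewrite E2 E3.
  by move=> x; rewrite inE => /orP [/eqP->|/s1].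
exists [::], p, ps.
have Ep : p = block_pair \/ p = last_pair.
  have := sub p (mem_head _ _); rewrite !inE (negbTE outer) orbF.
  by case/orP=> /eqP; [left | right].
have w0 : w = [::].
  case: w hw Ew => // a w; rewrite inE negb_or => /andP [/eqP ha _].
  by case: Ep => -> [] /esym.
by split=> //; rewrite w0 in Ew.
Qed.

(** Induction on the number of pairs. If the first outer pair is [last_pair], the current form is
    the start symbol. If it is [block_pair], the pairs up to the next outer pair derive the current
    form from an earlier one, for which fewer pairs remain. *)
Lemma corr_sound ps w : {subset ps <= corr_pairs} -> hash \notin w ->
  hash :: w ++ tops ps = bots ps -> star (psg_step G) [:: psS G] w.
Proof.
have [n] := ubnP (size ps); elim: n ps w => // n IH ps w szn sub hw E.
have [|ps1 [p [ps2 [Eps s1 Ep E1 E2]]]] := @corr_first_block ps [::] (w ++ tops ps) sub isT.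
  by [].
have [k1 k2 _] := inner_corr s1; rewrite -E1 in k1.
(* The inner pairs [ps1] in front of the first # have an empty bottom, so their tops derive the
   empty word. *)
have w1w : star (psg_step G) (w ++ tops ps1) w.
  by rewrite -[X in star _ _ X]cats0; apply: psg_star_catb => //; apply: rt_refl.
have hw1 : hash \notin w ++ tops ps1 by rewrite mem_cat negb_or hw.
apply: rt_trans w1w; move: E2; rewrite Eps tops_cat catA.
set w1 := w ++ _ in hw1 *.
have hS : psS G != hash.
  by apply/eqP => ES; have := hash_alphabet; rewrite -ES psS_alphabet.
case: Ep => Ep; last first.
  rewrite Ep => [[E2]].
  have hS1 : hash \notin [:: psS G] by rewrite inE eq_sym.
  have [-> _] := @cat_cons_first _ hash w1 (tops ps2) [:: psS G] (bots ps2) hw1 hS1 E2.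
  exact: rt_refl.
rewrite Ep => [[E2]].
have [|||ps3 [q [ps4 [Eps2 s3 Eq E3 E4]]]] := @corr_first_block ps2 w1 (tops ps2).
- by move=> x xs; apply: sub; rewrite Eps mem_cat inE xs !orbT.
- exact: hw1.
- exact: E2.
have [l1 l2 _] := inner_corr s3; rewrite -E3 in l1.
apply: rt_trans l1; apply: (IH (q :: ps4)) => //.
- by move: szn; rewrite Eps Eps2 !size_cat /= !size_cat /=; lia.
- by move=> x xs; apply: sub; rewrite Eps Eps2 mem_cat inE mem_cat xs !orbT.
by rewrite -E4 Eps2 tops_cat.
Qed.

Lemma corr_copy x : {subset x <= alphabet} ->
  exists2 ps : pairs, {subset ps <= corr_pairs} & tops ps = x /\ bots ps = x.
Proof.
move=> xA; exists [seq ([:: c], [:: c]) | c <- x]; last first.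
  by elim: x {xA} => //= c x [ht hb]; rewrite /tops /bots /= -/(tops (map _ _)) -/(bots (map _ _)) ht hb.
move=> _ /mapP [c xc ->]; rewrite !inE mem_cat.
by rewrite (map_f (fun c => ([:: c], [:: c]))) ?orbT //; apply: xA.
Qed.

(** The sequence lists the derivation backwards, so a step added at the end of the derivation
    becomes a block added in front: the context is copied letter by letter around the pair of the
    production. The inclusion in [alphabet] is carried along to allow this copying. *)
Lemma corr_complete w : star (psg_step G) [:: psS G] w ->
  {subset w <= alphabet} /\
  exists2 ps : pairs, {subset ps <= corr_pairs} & hash :: w ++ tops ps = bots ps.
Proof.
move: w; apply: star_ind_right.
  split; first by move=> x; rewrite inE => /eqP ->; apply: psS_alphabet.
  by exists [:: last_pair] => // x; rewrite !inE => ->; rewrite orbT.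
move=> _ _ _ [p [/In_mem Gp [x [y [-> ->]]]]] [sub [ps psub E]].
have [_ p2A] := psP_alphabet Gp.
have [|xs xsub [tx bx]] := @corr_copy x.
  by move=> a xa; apply: sub; rewrite mem_cat xa.
have [|ys ysub [ty by_]] := @corr_copy y.
  by move=> a ya; apply: sub; rewrite !mem_cat ya !orbT.
split.
  move=> a; rewrite [_ \in x ++ _]mem_cat [_ \in _ ++ y]mem_cat => /or3P [xa|/p2A //|ya]; apply: sub.
    by rewrite mem_cat xa.
  by rewrite !mem_cat ya !orbT.
exists (block_pair :: xs ++ p :: ys ++ ps).
  move=> q; rewrite inE mem_cat inE mem_cat.
  case/orP=> [/eqP->|/or4P [/xsub|/eqP->|/ysub|/psub] //]; rewrite !inE ?eqxx //.
  by rewrite mem_cat Gp !orbT.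
rewrite /tops /bots /= !map_cat !flatten_cat /= !map_cat !flatten_cat.
rewrite -/(tops _) -/(bots _) -/(tops _) -/(bots _) -/(tops _) -/(bots _).
by rewrite tx bx ty by_ -E /= -!catA /= -?catA.
Qed.

End Correspondence.

(** * Simulation by a simple matrix grammar *)

(** [true] stands for A and [false] for B. Equal numbers of both keep #A - #B unchanged when codes
    are inserted, and [a.+1] keeps the code of 0 nonempty, as injectivity requires. *)
Definition code1 a := nseq a.+1 true ++ nseq a.+1 false.
Definition code s := flatten [seq code1 a | a <- s].

Lemma code_cat s t : code (s ++ t) = code s ++ code t.
Proof. by rewrite /code map_cat flatten_cat. Qed.

Lemma code_cons a s : code (a :: s) = code1 a ++ code s.
Proof. by []. Qed.

Lemma nseq_true_inj a b s t :
  nseq a true ++ false :: s = nseq b true ++ false :: t -> a = b.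
Proof. by elim: a b => [|a IH] [|b] //= [/IH ->]. Qed.

Lemma code_inj : injective code.
Proof.
elim=> [|a s IH] [|b t] //; rewrite !code_cons => E.
move: (E); rewrite /code1 -!catA /= => - [/nseq_true_inj Eab]; rewrite Eab in E *.
by congr (_ :: _); apply: IH; apply/eqP; move/eqP: E; rewrite eqseq_cat // => /andP [].
Qed.

Lemma code_balanced s : count_mem true (code s) = count_mem false (code s).
Proof.
elim: s => [|a s IH] //; rewrite code_cons /code1 !count_cat !count_nseq IH /=.
by rewrite !mul0n !mul1n addn0 add0n.
Qed.

(** * Counting letters and inverting single replacements *)

Definition occ (X : nat) (s : seq nat) : nat := count_mem X s.

Lemma occ_nil X : occ X [::] = 0. Proof. by []. Qed.

Lemma occ_cons X a s : occ X (a :: s) = (a == X) + occ X s. Proof. by []. Qed.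

Lemma occ_cat X s t : occ X (s ++ t) = occ X s + occ X t.
Proof. exact: count_cat. Qed.

Lemma occ_nseq X n a : occ X (nseq n a) = (a == X) * n.
Proof. exact: count_nseq. Qed.

Lemma occP X s : reflect (occ X s = 0) (X \notin s).
Proof. exact: count_memPn. Qed.

Lemma occ0 X s : X \notin s -> occ X s = 0.
Proof. exact/occP. Qed.

Definition occE := (occ_cat, occ_cons, occ_nseq, occ_nil).

Lemma replace_one_occ X A x u v :
  replace_one A x u v -> occ X v + (A == X) = occ X u + occ X x.
Proof. by move=> [u1 [u2 [-> ->]]]; rewrite !occE; lia. Qed.

Lemma apply_rules_occ X rs u v : apply_rules rs u v ->
  occ X v + sumn [seq (p.1 == X : nat) | p <- rs] =
  occ X u + sumn [seq occ X p.2 | p <- rs].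
Proof.
elim: rs u => [|[A x] rs IH] u /=; first by move=> ->.
by move=> [w [/(replace_one_occ X) H /IH]]; move: H; case: (A == X) => /=; lia.
Qed.

Lemma replace_one_in A x u v : replace_one A x u v -> 0 < occ A u.
Proof. by move=> [u1 [u2 [-> _]]]; rewrite !occE eqxx /=; lia. Qed.

(** Inside a run of equal letters the erased occurrence does not affect the result. *)
Lemma replace_one_nseq A n l r v : A \notin l -> A \notin r ->
  replace_one A [::] (l ++ nseq n.+1 A ++ r) v -> v = l ++ nseq n A ++ r.
Proof.
move=> Al Ar [a [b [+ ->]]] /=; elim: l Al a => [|c l IH] /=.
  move=> _; elim: n => [|n IHn] [|c a] /=.
  - by case.
  - by case=> <- E; rewrite E mem_cat mem_head orbT in Ar.
  - by case.
  - by case=> <- /IHn ->.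
rewrite inE negb_or => /andP [/eqP Ac Al] [|d a] /=; first by case=> /esym.
by case=> -> /(IH Al) ->.
Qed.

Lemma replace_one_uniq A x l r v : A \notin l -> A \notin r ->
  replace_one A x (l ++ A :: r) v -> v = l ++ x ++ r.
Proof.
move=> Al Ar [a [b [/esym E ->]]].
rewrite -has_pred1 in Al; rewrite -has_pred1 in Ar.
by have [-> _ ->] := @cat_cons_uniq _ A A (pred1 A) a b l r (eqxx _) (eqxx _) Al Ar E.
Qed.

(** The only B of the result is the one just inserted, so A stood in its place. *)
Lemma replace_one_unreplace A B l r u : B \notin l -> B \notin r ->
  replace_one A [:: B] u (l ++ B :: r) -> u = l ++ A :: r.
Proof.
move=> Al Ar [a [b [-> /esym E]]].
rewrite -has_pred1 in Al; rewrite -has_pred1 in Ar.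
by have [-> _ ->] := @cat_cons_uniq _ B B (pred1 B) a b l r (eqxx _) (eqxx _) Al Ar E.
Qed.

Lemma replace_oneI A x l r : replace_one A x (l ++ A :: r) (l ++ x ++ r).
Proof. by exists l, r. Qed.

(** * Matrices of the simulator and the balance of A and B *)

Section Simulation.

Variable G : psgrammar.

Let T := psT G.
Let hash := hash G.
(** The simulator contains # only in coded form, so the number of # is free to serve as A. *)
Definition nA := hash.
Definition nB := hash.+1.
Definition nC := hash.+2.
Definition nS := hash.+3.

Definition syms (b : seq bool) := [seq (if x then nA else nB) | x <- b].
(** Mirrored because each new code on the right is inserted at the center, to the left of the
    earlier ones. Exchanging A and B in [botw] lets equal words cancel in pairs of opposite letters,
    which keeps #A - #B. *)
Definition topw u := syms (rev (code u)).
Definition botw v := syms (map negb (code v)).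

(* Erasing letters X before rewriting another X tests that enough letters X are
   present: two S in [m_read] and [m_turn], three C in [m_push] and [m_check]. *)
Definition umatrix rs := SCMMatrix rs None None.
Definition m_start := umatrix [:: (nB, [:: nS; nS; nC] ++ topw [:: hash])].
Definition m_read a :=
  umatrix [:: (nS, [::]); (nS, [:: a; nS; nS]); (nC, nC :: topw [:: a])].
Definition m_turn := umatrix [:: (nS, [::]); (nS, [::]); (nC, [:: nC; nC; nC])].
Definition m_push (p : seq nat * seq nat) :=
  umatrix [:: (nC, [::]); (nC, [::]); (nC, botw p.2 ++ [:: nC; nC; nC] ++ topw p.1)].
Definition m_check := umatrix [:: (nC, [::]); (nC, [::]); (nC, [:: nS])].
Definition m_mark := SCMMatrix [:: (nA, [:: nC]); (nB, [:: nC])] None (Some [:: nC]).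
Definition m_match :=
  SCMMatrix [:: (nC, [::]); (nC, [::])] (Some [:: nC; nS; nC]) None.
Definition m_stop := SCMMatrix [:: (nS, [::])] None (Some [:: nC]).

Definition simulator := SCMG ([:: nA; nB; nC; nS] ++ T) T
  ([:: m_start; m_turn; m_check; m_mark; m_match; m_stop]
     ++ [seq m_read a | a <- T] ++ [seq m_push p | p <- corr_pairs G]) nB.

Inductive later_matrix : scm_matrix -> Prop :=
| Later_read a of a \in T : later_matrix (m_read a)
| Later_turn : later_matrix m_turn
| Later_push p of p \in corr_pairs G : later_matrix (m_push p)
| Later_check : later_matrix m_check
| Later_mark : later_matrix m_mark
| Later_match : later_matrix m_match
| Later_stop : later_matrix m_stop.

Lemma simulator_matrixP r :
  List.In r (gM simulator) <-> r = m_start \/ later_matrix r.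
Proof.
rewrite /simulator /gM; set ps := map m_push _; set rs := map m_read _; split=> /=.
  do 6 (case; first by move=> <-; (try by left); right; constructor).
  by case/In_cat => /In_map [x /In_mem xT ->]; right; constructor.
case; first by move=> ->; left.
case=> [a aT||p pin||||]; do 6?[by left | right].
- by apply/In_cat; left; apply/In_map; exists a => //; apply/In_mem.
- by apply/In_cat; right; apply/In_map; exists p => //; apply/In_mem.
Qed.

Lemma nonterms_neq : (((nA == nB) = false) * ((nA == nC) = false) * ((nA == nS) = false)
  * ((nB == nA) = false) * ((nB == nC) = false) * ((nB == nS) = false)
  * ((nC == nA) = false) * ((nC == nB) = false) * ((nC == nS) = false)
  * ((nS == nA) = false) * ((nS == nB) = false) * ((nS == nC) = false))%type.
Proof. by rewrite /nA /nB /nC /nS; do !split; lia. Qed.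

Lemma hash_le : ((hash <= nA) * (hash <= nB) * (hash <= nC) * (hash <= nS))%type.
Proof. by rewrite /nA /nB /nC /nS; do !split; lia. Qed.

Lemma terminal_lt a : a \in T -> a < hash.
Proof. by move=> aT; apply: fresh_gt; rewrite mem_cat aT orbT. Qed.

Lemma occ_terminal X w : hash <= X -> all (mem T) w -> occ X w = 0.
Proof.
move=> hX /allP wT; apply/occP/negP => /wT /= /terminal_lt; lia.
Qed.

Lemma terminal_neq X a : hash <= X -> a \in T -> (a == X) = false.
Proof. by move=> hX /terminal_lt; lia. Qed.

Lemma occ_syms X b : occ X (syms b) =
  (X == nA) * count_mem true b + (X == nB) * count_mem false b.
Proof.
elim: b => [|x b IH] /=; first by rewrite !muln0.
by rewrite IH !(eq_sym X); case: x => /=; rewrite ?mulnDr; lia.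
Qed.

Lemma occ_topw X u :
  occ X (topw u) = ((X == nA) + (X == nB)) * count_mem true (code u).
Proof. by rewrite /topw occ_syms !count_rev -code_balanced mulnDl. Qed.

Lemma count_map_negb x b : count_mem x (map negb b) = count_mem (~~ x) b.
Proof. by rewrite count_map; apply: eq_count => y /=; case: x; case: y. Qed.

Lemma occ_botw X u :
  occ X (botw u) = ((X == nA) + (X == nB)) * count_mem true (code u).
Proof. by rewrite /botw occ_syms !count_map_negb /= -code_balanced mulnDl. Qed.

Definition balanced s := occ nA s = occ nB s.
Notation reaches := (star (scm_step simulator)).

Definition simE := (occE, occ_topw, occ_botw, eqxx, nonterms_neq).

Lemma later_balanced r s s1 : later_matrix r -> mstep r s s1 ->
  occ nA s1 + occ nB s = occ nA s + occ nB s1.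
Proof.
move=> kr [_ _ rs].
have /= := apply_rules_occ nA rs; have /= := apply_rules_occ nB rs.
case: kr {rs} => [a aT||p pin||||] /=; rewrite !simE /= ?simE ?terminal_neq //.
all: rewrite /nB /nA; lia.
Qed.

Lemma start_unbalances s s1 : mstep m_start s s1 ->
  (occ nA s1 + occ nB s) = (occ nA s + occ nB s1).+1.
Proof.
move=> [_ _ rs].
have /= := apply_rules_occ nA rs; have /= := apply_rules_occ nB rs.
rewrite !simE /=; lia.
Qed.

(* [m_start] is the only matrix that changes #A - #B, and it increases it. *)
Lemma reaches_terminal_le s t : reaches s t -> all (mem T) t ->
  occ nA s <= occ nB s.
Proof.
move=> st tT; move: s st; apply: star_ind_left.
  by rewrite !occ_terminal // /nB; lia.
move=> x y [r [/simulator_matrixP [->|kr] xy]] _.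
  by have := start_unbalances xy; lia.
by have := later_balanced kr xy; lia.
Qed.

(** A further use of [m_start] would make #A exceed #B, and then no terminal word could be
    reached. *)
Lemma step_later s s1 t : scm_step simulator s s1 -> reaches s1 t ->
  all (mem T) t -> balanced s ->
  balanced s1 /\ exists2 r, later_matrix r & mstep r s s1.
Proof.
rewrite /balanced; move=> [r [/simulator_matrixP [->|kr] xy]] yt tT bal.
  by have := start_unbalances xy; have := reaches_terminal_le yt tT; lia.
by have := later_balanced kr xy; split; [lia | exists r].
Qed.

(** The first rule uses up the only S there may be. The arbitrary conclusion [u] closes any goal. *)
Lemma two_nS_needed s s1 (u : Prop) x rs : occ nS s <= 1 ->
  apply_rules [:: (nS, [::]), (nS, x) & rs] s s1 -> u.
Proof.
move=> le1 [s' [ss' [s'' [/replace_one_in pos _]]]].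
by exfalso; have /= := replace_one_occ nS ss'; rewrite eqxx /=; lia.
Qed.

Lemma three_nC_needed s s1 (u : Prop) x : occ nC s <= 2 ->
  apply_rules [:: (nC, [::]); (nC, [::]); (nC, x)] s s1 -> u.
Proof.
move=> le2 [s' [ss' [s'' [ss'' [s''' [/replace_one_in pos _]]]]]].
exfalso; have /= := replace_one_occ nC ss'.
by have /= := replace_one_occ nC ss''; rewrite eqxx /=; lia.
Qed.

Lemma mem1_forbidden s : ~~ infix [:: nC] s -> occ nC s = 0.
Proof.
move=> h; apply/occP; apply: contra h => /path.splitPr [s1 s2].
by apply/infixP; exists s1, s2.
Qed.

Lemma match_needs s : infix [:: nC; nS; nC] s -> 1 < occ nC s /\ 0 < occ nS s.
Proof.
by move=> /infixP [a [b ->]]; rewrite !occE /= !simE /=; lia.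
Qed.

(** * Soundness of the simulator, treating the phases from the last to the first *)

Section Soundness.

Variable t : seq nat.
Hypothesis tT : all (mem T) t.

(** Without S and with at most two C only [m_mark] could apply. It produces two C, and the induction
    hypothesis makes its result equal to [t], which contains no C. *)
Lemma no_nS_stuck s : reaches s t -> balanced s -> occ nS s = 0 ->
  occ nC s <= 2 -> s = t.
Proof.
move: s; apply: star_ind_left => // x y xy yt IH bal S0 C2.
have [baly [r kr [hP hF rs]]] := step_later xy yt tT bal.
case: kr hP hF rs => [a aT||p pin||||] hP hF rs.
- by apply: two_nS_needed rs; rewrite S0.
- by apply: two_nS_needed rs; rewrite S0.
- exact: three_nC_needed rs.
- exact: three_nC_needed rs.
- have C0 := mem1_forbidden hF.
  have /= := apply_rules_occ nC rs; have /= := apply_rules_occ nS rs.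
  rewrite !simE /= => HS HC.
  have Et : y = t by apply: IH => //; lia.
  by have := occ_terminal (hash_le.1.2) tT; rewrite -Et; lia.
- by have := match_needs hP; lia.
- by case: rs => w [/replace_one_in]; rewrite S0.
Qed.

(** The words on the two sides of S for which cancellation can succeed. The number [d] counts the
    letters next to S, on each side, that are already renamed to C. *)
Definition matched p q := exists d pb qb,
  [/\ p = syms pb ++ nseq d nC, q = nseq d nC ++ syms qb & rev qb = map negb pb].

Lemma syms_rcons b x : syms (rcons b x) = rcons (syms b) (if x then nA else nB).
Proof. by rewrite /syms map_rcons. Qed.

Lemma nC_syms b : nC \notin syms b.
Proof. by apply/occP; rewrite occ_syms !simE. Qed.

Lemma nS_syms b : nS \notin syms b.
Proof. by apply/occP; rewrite occ_syms !simE. Qed.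

Definition marked A p q p1 q1 :=
  (replace_one A [:: nC] p p1 /\ q1 = q) \/ (replace_one A [:: nC] q q1 /\ p1 = p).

Lemma replace_one_split A x w p q v : A \notin w -> A != nS ->
  replace_one A x (w ++ p ++ nS :: q) v ->
  (exists2 p1, replace_one A x p p1 & v = w ++ p1 ++ nS :: q) \/
  (exists2 q1, replace_one A x q q1 & v = w ++ p ++ nS :: q1).
Proof.
move=> Aw AS [a [b [/esym E ->]]].
have [[p2 [Ew _]]|[q1 [Eq ->]]] := cat_cons_split E.
  by rewrite Ew mem_cat mem_head orbT in Aw.
have [[p2 [-> ->]]|[q2 [Eq2 ->]]] := cat_cons_split (esym Eq).
  by left; exists (q1 ++ x ++ p2); rewrite -?catA //; exists q1, p2.
case: q2 Eq2 => [|c q2] /= [Ec Eq2]; first by rewrite Ec eqxx in AS.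
right; exists (q2 ++ x ++ b); first by exists q2, b.
by rewrite -Ec -!catA.
Qed.

(** After marking, [matched] demands equally many C on both sides of S, so the two marks lie on
    different sides and [d] is 1. The C on each side is next to S, hence the marked letters were the
    neighbours of S and were opposite. *)
Lemma unmark_matched p q p1 q1 p2 q2 : nC \notin p -> nC \notin q ->
  marked nA p q p1 q1 -> marked nB p1 q1 p2 q2 -> matched p2 q2 -> matched p q.
Proof.
move=> Cp Cq mA mB [d [pb [qb [Ep2 Eq2 Eb]]]].
have Cp0 : occ nC p = 0 by apply/occP.
have Cq0 : occ nC q = 0 by apply/occP.
have := congr1 (occ nC) Ep2; have := congr1 (occ nC) Eq2.
rewrite !occE !occ_syms /= !simE /= => Hq2 Hp2.
have cnt1 A u v : (A == nC) = false -> replace_one A [:: nC] u v ->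
    occ nC v = (occ nC u).+1.
  by move=> AnC /(replace_one_occ nC) /=; rewrite AnC !simE; lia.
have nC0 : nC \notin ([::] : seq nat) by [].
have neg b : nC \notin syms b by apply: nC_syms.
case: mA => [] [mA EA]; case: mB => [] [mB EB].
- have := cnt1 _ _ _ _ mA; have := cnt1 _ _ _ _ mB; rewrite !nonterms_neq.
  by move=> /(_ erefl) h1 /(_ erefl) h2; move: Hq2 Hp2; rewrite EB EA; lia.
- have := cnt1 _ _ _ _ mA; have := cnt1 _ _ _ _ mB; rewrite !nonterms_neq.
  move=> /(_ erefl) h1 /(_ erefl) h2.
  have d1 : d = 1 by move: Hp2; rewrite EB; lia.
  rewrite d1 /= in Ep2 Eq2; rewrite -EB Ep2 in mA; rewrite EA Eq2 in mB.
  rewrite (replace_one_unreplace (neg pb) nC0 mA).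
  rewrite (@replace_one_unreplace nB nC [::] (syms qb) q nC0 (neg qb) mB).
  exists 0, (rcons pb true), (false :: qb); split=> //=.
  + by rewrite syms_rcons cats0 cats1.
  + by rewrite rev_cons map_rcons Eb.
- have := cnt1 _ _ _ _ mA; have := cnt1 _ _ _ _ mB; rewrite !nonterms_neq.
  move=> /(_ erefl) h1 /(_ erefl) h2.
  have d1 : d = 1 by move: Hq2; rewrite EB; lia.
  rewrite d1 /= in Ep2 Eq2; rewrite EA Ep2 in mB; rewrite -EB Eq2 in mA.
  rewrite (replace_one_unreplace (neg pb) nC0 mB).
  rewrite (@replace_one_unreplace nA nC [::] (syms qb) q nC0 (neg qb) mA).
  exists 0, (rcons pb false), (true :: qb); split=> //=.
  + by rewrite syms_rcons cats0 cats1.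
  + by rewrite rev_cons map_rcons Eb.
- have := cnt1 _ _ _ _ mA; have := cnt1 _ _ _ _ mB; rewrite !nonterms_neq.
  by move=> /(_ erefl) h1 /(_ erefl) h2; move: Hq2 Hp2; rewrite EB EA; lia.
Qed.

Definition stack_word p := all (fun a => (a == nA) || (a == nB) || (a == nC)) p.

Lemma stack_word_nS p : stack_word p -> nS \notin p.
Proof. by move=> /allP h; apply/negP => /h; rewrite !simE. Qed.

Lemma stack_word_replace A p p1 : replace_one A [:: nC] p p1 -> stack_word p -> stack_word p1.
Proof.
move=> [a [b [-> ->]]]; rewrite /stack_word !all_cat /= => /and3P [-> _ ->].
by rewrite eqxx orbT.
Qed.

Lemma stack_word_terminal p : stack_word p -> all (mem T) p -> p = [::].
Proof.
case: p => // a p /= /andP [h _] /andP [/terminal_lt aT _].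
by move: h; rewrite /nA /nB /nC; lia.
Qed.

(** With one S and at most two C, only [m_mark], [m_match] and [m_stop] can apply. Each of the first
    two keeps the shape of the word, and [matched] is carried back from the result to the word
    before the step. *)
Lemma cancel_phase s : reaches s t -> forall w p q, s = w ++ p ++ nS :: q ->
  all (mem T) w -> stack_word p -> stack_word q -> balanced s ->
  occ nC s <= 2 -> t = w /\ matched p q.
Proof.
move: s; apply: star_ind_left.
  move=> w p q Et; exfalso; move: tT; rewrite Et !all_cat /= => /and4P [_ _ + _].
  by move/terminal_lt; rewrite /nS; lia.
move=> x y xy yt IH w p q Ex wT sp sq bal C2.
have [baly [r kr [hP hF rs]]] := step_later xy yt tT bal.
have Sp := stack_word_nS sp; have Sq := stack_word_nS sq.
have Sw : nS \notin w.
  by apply/occP; rewrite (occ_terminal _ wT) ?hash_le.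
have Cw : nC \notin w.
  by apply/occP; rewrite (occ_terminal _ wT) ?hash_le.
have S1 : occ nS x = 1.
  by rewrite Ex !occE /= eqxx !occ0.
case: kr hP hF rs => [a aT||c pin||||] hP hF rs.
- by apply: two_nS_needed rs; rewrite S1.
- by apply: two_nS_needed rs; rewrite S1.
- exact: three_nC_needed rs.
- exact: three_nC_needed rs.
- have C0 := mem1_forbidden hF.
  have Cp : nC \notin p.
    by apply/occP; move: C0; rewrite Ex !occE /=; lia.
  have Cq : nC \notin q.
    by apply/occP; move: C0; rewrite Ex !occE /=; lia.
  have /= := apply_rules_occ nC rs; rewrite !simE /= => HC.
  have C2y : occ nC y <= 2 by clear - HC C0; lia.
  have notw A : hash <= A -> A \notin w.
    by move=> hA; apply/occP; rewrite (occ_terminal hA wT).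
  have [z [xz [z' [zy' ez]]]] := rs; rewrite {}ez in zy'.
  rewrite Ex in xz.
  have [p1 [q1 [Ez mA sp1 sq1]]] : exists p1 q1,
      [/\ z = w ++ p1 ++ nS :: q1, marked nA p q p1 q1, stack_word p1 & stack_word q1].
    have [||[p1 h ->]|[q1 h ->]] := replace_one_split _ _ xz.
    + exact: notw.
    + by rewrite nonterms_neq.
    + by exists p1, q; split=> //; [left | apply: stack_word_replace h _].
    + by exists p, q1; split=> //; [right | apply: stack_word_replace h _].
  rewrite Ez in zy'.
  have [p2 [q2 [Ey mB sp2 sq2]]] : exists p2 q2,
      [/\ y = w ++ p2 ++ nS :: q2, marked nB p1 q1 p2 q2, stack_word p2 & stack_word q2].
    have [||[p2 h ->]|[q2 h ->]] := replace_one_split _ _ zy'.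
    + by apply: notw; rewrite hash_le.
    + by rewrite nonterms_neq.
    + by exists p2, q1; split=> //; [left | apply: stack_word_replace h _].
    + by exists p1, q2; split=> //; [right | apply: stack_word_replace h _].
  have [-> m2] := IH w p2 q2 Ey wT sp2 sq2 baly C2y.
  by split=> //; apply: unmark_matched mA mB m2.
(* There is one S, so the required factor CSC surrounds it. With at most two C in all, these are
   exactly the two that get erased. *)
- have /infixP [a [b Eab]] := hP.
  have Eab' : w ++ p ++ nS :: q = (a ++ [:: nC]) ++ nS :: nC :: b.
    by rewrite -Ex Eab -!catA.
  have [Ewp Eq] : w ++ p = a ++ [:: nC] /\ q = nC :: b.
    rewrite catA in Eab'; apply: cat_cons_first Eab'.
    - by rewrite mem_cat negb_or Sw.
    - have := S1; rewrite Eab !occE /= !simE => S1'.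
      by apply/occP; rewrite !occE /= !simE; lia.
  have [p0 Ep] : exists p0, p = p0 ++ [:: nC].
    case/lastP: (p) Ewp => [|p0 c].
      by rewrite cats0 => Ew; move: Cw; rewrite Ew mem_cat mem_head orbT.
    by rewrite -rcons_cat cats1 => /rcons_inj [_ ->]; exists p0; rewrite cats1.
  have C2' : occ nC p0 + occ nC b = 0.
    by move: C2; rewrite Ex Ep Eq !occE /= !simE; lia.
  have /= := apply_rules_occ nC rs; rewrite !simE /= => HC.
  have Ey : y = w ++ p0 ++ nS :: b.
    (* Filtering out C hides which occurrences are erased. No C remains in [y], so [y] is [x]
       without its letters C. *)
    have filt u v : replace_one nC [::] u v ->
        filter (predC1 nC) v = filter (predC1 nC) u.
      by move=> [u1 [u2 [-> ->]]]; rewrite !filter_cat /= eqxx.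
    have Cy : occ nC y = 0.
      by move: HC; rewrite Ex Ep Eq !occE /= !simE (occ0 Cw); lia.
    have nofilt v : occ nC v = 0 -> filter (predC1 nC) v = v.
      by move=> v0; apply/all_filterP; rewrite all_predC has_pred1; apply/occP.
    case: rs => z [/filt xz [z' [/filt zy ez]]]; rewrite -(nofilt y) // -ez zy xz.
    rewrite Ex Ep Eq !filter_cat /= !simE /= !nofilt ?cats0 //; first by lia.
    + by lia.
    + exact/occP.
  have [|||-> [d [pb [qb [Ep0 Eb Em]]]]] := IH w p0 b Ey wT _ _ baly.
  + by move: sp; rewrite Ep /stack_word all_cat => /andP [].
  + by move: sq; rewrite Eq /= => /andP [].
  + by lia.
  split=> //; exists 1, pb, qb.
  have d0 : d = 0 by move: C2'; rewrite Ep0 Eb !occE !simE; lia.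
  by rewrite Ep Ep0 Eq Eb d0 /= cats0.
(* Erasing S leaves neither S nor C, so by [no_nS_stuck] the word is already [t], and both stacks
   are empty. *)
- have C0 := mem1_forbidden hF.
  case: rs => y' [xy' ey]; rewrite {y'}ey in xy'.
  have Ey : y = w ++ p ++ q.
    move: xy'; rewrite Ex catA => /replace_one_uniq ->; rewrite ?catA //.
    by rewrite mem_cat negb_or Sw.
  have Et : y = t.
    apply: no_nS_stuck => //; first by rewrite Ey !occE !occ0.
    by move: C0; rewrite Ex Ey !occE; lia.
  have := tT; rewrite -Et Ey !all_cat => /and3P [_ pT qT].
  rewrite (stack_word_terminal sp pT) (stack_word_terminal sq qT) !cats0.
  by split=> //; exists 0, [::], [::].
Qed.

Lemma stack_word_syms b : stack_word (syms b).
Proof.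
by rewrite /stack_word all_map; apply/allP => -[] _; rewrite /= !simE ?orbT.
Qed.

Lemma terminal_notin X w : hash <= X -> all (mem T) w -> X \notin w.
Proof. by move=> hX wT; apply/occP; apply: occ_terminal. Qed.

Lemma matched_syms pb qb : matched (syms pb) (syms qb) -> rev qb = map negb pb.
Proof.
have syms_inj : injective syms.
  by apply: inj_map => -[] [] // /eqP; rewrite nonterms_neq.
move=> [d [pb' [qb' [Ep Eq E]]]].
have d0 : d = 0.
  by have := congr1 (occ nC) Ep; rewrite !occE !occ_syms !simE; lia.
by move: Ep Eq; rewrite d0 cats0 /= => /syms_inj -> /syms_inj ->.
Qed.

(** The list [ps] consists of the pairs still to be pushed: the right stack continued by their tops
    and the complemented left stack continued by their bottoms must spell the same word. *)
Lemma push_phase s : reaches s t -> forall w pb qb,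
  s = w ++ syms pb ++ [:: nC; nC; nC] ++ syms qb ->
  all (mem T) w -> balanced s -> t = w /\
  exists2 ps : pairs, {subset ps <= corr_pairs G} &
    rev qb ++ code (tops ps) = map negb pb ++ code (bots ps).
Proof.
move: s; apply: star_ind_left.
  move=> w p q Et; exfalso; have := occ_terminal hash_le.1.2 tT.
  by rewrite Et !occE !eqxx; lia.
move=> x y xy yt IH w pb qb Ex wT bal.
have [baly [r kr [hP hF rs]]] := step_later xy yt tT bal.
have Cw := terminal_notin hash_le.1.2 wT; have Sw := terminal_notin hash_le.2 wT.
have S0 : occ nS x = 0 by rewrite Ex !occE !occ_syms !simE (occ0 Sw).
have C3 : occ nC x = 3 by rewrite Ex !occE !occ_syms !simE (occ0 Cw).
have Cl : nC \notin w ++ syms pb by rewrite mem_cat negb_or Cw nC_syms.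
(* The three C form one run, so the result does not depend on which two are erased and which one is
   rewritten. *)
have cut (z : seq nat) : apply_rules [:: (nC, [::]); (nC, [::]); (nC, z)] x y ->
    y = w ++ syms pb ++ z ++ syms qb.
  case=> x1 [xx1 [x2 [x12 [x3 [x23 <-]]]]].
  move: xx1; rewrite Ex catA => /(@replace_one_nseq nC 2) E1.
  rewrite {}E1 ?nC_syms // in x12; move/(@replace_one_nseq nC 1): x12 => E2.
  rewrite {}E2 ?nC_syms // in x23; move/replace_one_uniq: x23 => ->; rewrite -?catA //.
  exact: nC_syms.
case: kr hP hF rs => [a aT||c pin||||] hP hF rs.
- by apply: two_nS_needed rs; rewrite S0.
- by apply: two_nS_needed rs; rewrite S0.
- have Ey := cut _ rs.
  have [|-> [ps sub E]] := IH w (pb ++ map negb (code c.2)) (rev (code c.1) ++ qb) _ wT baly.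
    by rewrite Ey /syms !map_cat -!catA.
  split=> //; exists (c :: ps); first by move=> z; rewrite inE => /orP [/eqP->|/sub].
  move: E; rewrite rev_cat revK map_cat (mapK negbK) -!catA -!code_cat.
  by [].
(* [m_check] ends the phase, and the cancellation that follows forces the two stacks to agree with
   no further pairs. *)
- have Ey := cut _ rs.
  have [|||-> m] := cancel_phase yt Ey wT _ _ baly; rewrite ?stack_word_syms //.
    by rewrite Ey !occE !occ_syms !simE (occ0 Cw).
  by split=> //; exists [::] => //; rewrite !cats0; apply: matched_syms.
- by have := mem1_forbidden hF; rewrite C3.
- by have := match_needs hP; rewrite S0; lia.
- by have := mem1_forbidden hF; rewrite C3.
Qed.

Hypothesis Gwf : psg_wf G.

(** [m_read] extends [w] and its mirrored code together. [m_turn] enters the push phase with an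
    empty left stack, and [code_inj] turns the equality of codes found there into a solution for
    [corr_sound]. *)
Lemma read_phase s : reaches s t -> forall w yb,
  s = w ++ [:: nS; nS; nC] ++ syms yb -> rev yb = code (hash :: w) ->
  all (mem T) w -> balanced s -> star (psg_step G) [:: psS G] t.
Proof.
move: s; apply: star_ind_left.
  move=> w yb Et; exfalso; have := occ_terminal hash_le.1.2 tT.
  by rewrite Et !occE !eqxx; lia.
move=> x y xy yt IH w yb Ex Eyb wT bal.
have [baly [r kr [hP hF rs]]] := step_later xy yt tT bal.
have Cw := terminal_notin hash_le.1.2 wT; have Sw := terminal_notin hash_le.2 wT.
have C1 : occ nC x = 1 by rewrite Ex !occE !occ_syms !simE (occ0 Cw).
have Sr : nS \notin nC :: syms yb by rewrite inE negb_or nS_syms nonterms_neq.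
case: kr hP hF rs => [a aT||c pin||||] hP hF rs.
- case: rs => x1 [xx1 [x2 [x12 [x3 [x23 ey]]]]]; rewrite {x3}ey in x23.
  move: xx1; rewrite Ex => /(@replace_one_nseq nS 1) E1.
  rewrite {}E1 // in x12; move/replace_one_uniq: x12 => E2.
  rewrite {}E2 // in x23.
  have Cl : nC \notin w ++ [:: a; nS; nS].
    by rewrite mem_cat negb_or Cw !inE eq_sym (terminal_neq hash_le.1.2) // !nonterms_neq.
  move: x23; rewrite catA => /replace_one_uniq Ey.
  apply: (IH (rcons w a) (rev (code [:: a]) ++ yb)) => //.
  + by rewrite Ey ?nC_syms // /topw /syms map_cat cat_rcons -!catA.
  + by rewrite rev_cat revK Eyb -code_cat -cats1.
  + by rewrite all_rcons wT andbT.
- case: rs => x1 [xx1 [x2 [x12 [x3 [x23 ey]]]]]; rewrite {x3}ey in x23.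
  move: xx1; rewrite Ex => /(@replace_one_nseq nS 1) E1.
  rewrite {}E1 // in x12; move/(@replace_one_nseq nS 0): x12 => E2.
  rewrite {}E2 // in x23; move/replace_one_uniq: x23 => Ey.
  have [|-> [ps sub]] := push_phase yt (w := w) (pb := [::]) (qb := yb) _ wT baly.
    by rewrite Ey // nC_syms.
  rewrite Eyb -code_cat => /code_inj E.
  apply: corr_sound sub _ E => //.
  exact: terminal_notin.
- by apply: three_nC_needed rs; rewrite C1.
- by apply: three_nC_needed rs; rewrite C1.
- by have := mem1_forbidden hF; rewrite C1.
- by have := match_needs hP; rewrite C1; lia.
- by have := mem1_forbidden hF; rewrite C1.
Qed.

(** The start word B admits only [m_start], since each other matrix needs an A, a C or an S. *)
Lemma simulator_sound : reaches [:: nB] t -> star (psg_step G) [:: psS G] t.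
Proof.
suff H s : reaches s t -> s = [:: nB] -> star (psg_step G) [:: psS G] t.
  by move=> h; apply: H h _.
move: s; apply: star_ind_left.
  by move=> Et; have := occ_terminal hash_le.1.1.2 tT; rewrite Et occ_cons eqxx.
move=> x y [r [/simulator_matrixP kr [hP hF rs]]] yt _ Ex; rewrite {x}Ex in hP hF rs.
case: kr hP hF rs => [->|[a aT||c pin||||]] hP hF rs.
- case: rs => z [+ ey]; rewrite {z}ey => /(@replace_one_uniq nB _ [::] [::]) Ey.
  apply: (read_phase yt (w := [::]) (yb := rev (code [:: hash]))).
  + by rewrite Ey // cats0.
  + exact: revK.
  + by [].
  + by rewrite Ey // /balanced /= !simE.
- by apply: two_nS_needed rs; rewrite !simE.
- by apply: two_nS_needed rs; rewrite !simE.
- by apply: three_nC_needed rs; rewrite !simE.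
- by apply: three_nC_needed rs; rewrite !simE.
- by case: rs => z [/replace_one_in]; rewrite !simE.
- by have := match_needs hP; rewrite !simE => -[].
- by case: rs => z [/replace_one_in]; rewrite !simE.
Qed.

End Soundness.

(** * Completeness of the simulator: runs of the three phases *)

Lemma simulator_step r s s1 : r = m_start \/ later_matrix r -> mstep r s s1 ->
  reaches s s1.
Proof. by move=> /simulator_matrixP kr st; apply: rt_step; exists r. Qed.

Lemma topw_cat u v : topw (u ++ v) = topw v ++ topw u.
Proof. by rewrite /topw code_cat rev_cat /syms map_cat. Qed.

Lemma botw_cat u v : botw (u ++ v) = botw u ++ botw v.
Proof. by rewrite /botw code_cat /syms !map_cat. Qed.

Lemma read_run w : all (mem T) w ->
  reaches [:: nB] (w ++ [:: nS; nS; nC] ++ topw (hash :: w)).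
Proof.
elim/last_ind: w => [|w a IH].
  move=> _; apply: (simulator_step (or_introl erefl)); split=> //.
  eexists; split; last by [].
  by exists [::], [::]; rewrite cats0.
rewrite all_rcons => /andP [aT /IH h]; apply: rt_trans h _.
apply: (simulator_step (or_intror (Later_read aT))); split=> //.
exists (w ++ [:: nS; nC] ++ topw (hash :: w)); split; first exact: replace_oneI.
exists (w ++ [:: a; nS; nS; nC] ++ topw (hash :: w)); split; first exact: replace_oneI.
exists ((w ++ [:: a; nS; nS]) ++ (nC :: topw [:: a]) ++ topw (hash :: w)).
split.
  rewrite (_ : w ++ _ = (w ++ [:: a; nS; nS]) ++ nC :: topw (hash :: w)); last by rewrite -catA.
  exact: replace_oneI.
by rewrite /= -cats1 -?catA /= -(cat_cons hash) topw_cat -?catA.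
Qed.

Lemma push_run l r ps : {subset ps <= corr_pairs G} ->
  reaches (l ++ [:: nC; nC; nC] ++ r)
    (l ++ botw (bots ps) ++ [:: nC; nC; nC] ++ topw (tops ps) ++ r).
Proof.
elim: ps l r => [|c ps IH] l r sub; first exact: rt_refl.
have cin : c \in corr_pairs G by apply: sub; rewrite mem_head.
apply: (@rt_trans _ _ _ ((l ++ botw c.2) ++ [:: nC; nC; nC] ++ topw c.1 ++ r)).
  apply: (simulator_step (or_intror (Later_push cin))); split=> //.
  exists (l ++ [:: nC; nC] ++ r); split; first exact: replace_oneI.
  exists (l ++ [:: nC] ++ r); split; first exact: replace_oneI.
  eexists; split; first exact: replace_oneI.
  by rewrite -!catA.
have := IH (l ++ botw c.2) (topw c.1 ++ r).
rewrite (_ : tops (c :: ps) = c.1 ++ tops ps) // (_ : bots (c :: ps) = c.2 ++ bots ps) //.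
rewrite topw_cat botw_cat -!catA; apply=> z zps.
by apply: sub; rewrite inE zps orbT.
Qed.

Lemma unmarked_not_infix s : nC \notin s -> ~~ infix [:: nC] s.
Proof.
by apply: contra => /infixP [u [v ->]]; rewrite mem_cat mem_head orbT.
Qed.

Lemma cancel_run w b : nC \notin w ->
  reaches (w ++ syms (map negb b) ++ nS :: syms (rev b)) (w ++ [:: nS]).
Proof.
move=> Cw; elim/last_ind: b => [|b x IH]; first exact: rt_refl.
apply: rt_trans IH; rewrite map_rcons rev_rcons syms_rcons -cats1 catA.
rewrite [w ++ syms _ ++ nS :: _]catA.
have : nC \notin w ++ syms (map negb b) by rewrite mem_cat negb_or Cw nC_syms.
rewrite [w ++ syms _ ++ _]catA.
have : nC \notin syms (rev b) by apply: nC_syms.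
rewrite [syms (x :: _)]/=; move: (w ++ _) (syms (rev b)) => L R CR CL.
apply: (@rt_trans _ _ _ (L ++ [:: nC; nS; nC] ++ R)).
  apply: (simulator_step (or_intror Later_mark)); split=> //.
    apply: unmarked_not_infix; rewrite !mem_cat !inE !negb_or CL CR.
    by case: x; rewrite !nonterms_neq.
  (* [m_mark] renames A before B, and [x] tells on which side of S the A stands. *)
  case: x => /=.
    exists ((L ++ [:: nB; nS]) ++ [:: nC] ++ R); split.
      rewrite (_ : (L ++ [:: nB]) ++ _ = (L ++ [:: nB; nS]) ++ nA :: R); last by rewrite -!catA.
      exact: replace_oneI.
    exists (L ++ [:: nC] ++ nS :: nC :: R); split=> //.
    by rewrite -catA; apply: replace_oneI.
  exists (L ++ [:: nC] ++ nS :: nB :: R); split; first by rewrite -catA; apply: replace_oneI.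
  exists (L ++ [:: nC; nS; nC] ++ R); split=> //.
  rewrite (_ : L ++ [:: nC] ++ _ = (L ++ [:: nC; nS]) ++ nB :: R); last by rewrite -!catA.
  rewrite (_ : L ++ [:: nC; nS; nC] ++ R = (L ++ [:: nC; nS]) ++ [:: nC] ++ R);
    last by rewrite -catA.
  exact: replace_oneI.
apply: (simulator_step (or_intror Later_match)); split=> //.
  by apply/infixP; exists L, R.
exists (L ++ [::] ++ [:: nS; nC] ++ R); split; first exact: replace_oneI.
exists ((L ++ [:: nS]) ++ [::] ++ R); split; last by rewrite -catA.
rewrite (_ : L ++ _ = (L ++ [:: nS]) ++ nC :: R); last by rewrite -!catA.
exact: replace_oneI.
Qed.

Lemma simulator_complete w : psg_wf G -> all (mem T) w ->
  star (psg_step G) [:: psS G] w -> reaches [:: nB] w.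
Proof.
move=> Gwf wT /(corr_complete Gwf) [_ [ps sub E]].
have Cw := terminal_notin hash_le.1.2 wT.
apply: rt_trans (read_run wT) _.
apply: (@rt_trans _ _ _ (w ++ [:: nC; nC; nC] ++ topw (hash :: w))).
  apply: (simulator_step (or_intror Later_turn)); split=> //.
  exists (w ++ [:: nS; nC] ++ topw (hash :: w)); split; first exact: replace_oneI.
  exists (w ++ [:: nC] ++ topw (hash :: w)); split; first exact: replace_oneI.
  by eexists; split; first exact: replace_oneI.
apply: rt_trans (push_run _ _ sub) _.
have {}E : (hash :: w) ++ tops ps = bots ps by [].
rewrite -topw_cat E.
apply: (@rt_trans _ _ _ (w ++ botw (bots ps) ++ nS :: topw (bots ps))).
  rewrite !(catA w); apply: (simulator_step (or_intror Later_check)); split=> //.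
  eexists; split; first exact: replace_oneI.
  eexists; split; first exact: replace_oneI.
  by eexists; split; first exact: replace_oneI.
apply: rt_trans (cancel_run _ Cw) _.
apply: (simulator_step (or_intror Later_stop)); split=> //.
  by apply: unmarked_not_infix; rewrite mem_cat negb_or Cw inE nonterms_neq.
exists (w ++ [::] ++ [::]); split; first exact: replace_oneI.
by rewrite !cats0.
Qed.

(** * Well-formedness and parameters of the simulator *)

Lemma simulator_wf : psg_wf G -> scm_wf simulator.
Proof.
move=> Gwf.
have V_T : {subset T <= gV simulator} by move=> a aT; rewrite !inE aT !orbT.
have notT X : hash <= X -> X \notin T by move=> hX; apply/negP => /terminal_lt; lia.
have nt : all (is_nonterm simulator) [:: nA; nB; nC; nS].
  by rewrite /= /is_nonterm /= !inE !eqxx !orbT !notT ?hash_le.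
have [ntA ntB ntC ntS] : [/\ is_nonterm simulator nA, is_nonterm simulator nB,
    is_nonterm simulator nC & is_nonterm simulator nS].
  by case/and5P: nt.
have inV X : is_nonterm simulator X -> X \in gV simulator by case/andP.
have symsV b : all (fun a => a \in gV simulator) (syms b).
  by rewrite /syms all_map; apply/allP => -[] _; rewrite /= inV.
split=> //; first by exists nB.
move=> r /simulator_matrixP [->|].
  by split=> //; rewrite /= ntB !inV //= symsV.
case=> [a aT||p pin||||]; split=> //=.
- by rewrite ntC ntS (V_T a aT) (inV _ ntC) (inV _ ntS) symsV.
- by rewrite ntC ntS (inV _ ntC).
- by rewrite ntC all_cat /= (inV _ ntC) !symsV.
- by rewrite ntC (inV _ ntS).
- by rewrite ntA ntB (inV _ ntC).
- by rewrite (inV _ ntC).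
- by rewrite ntC.
- by rewrite (inV _ ntC) (inV _ ntS).
- by rewrite ntS.
- by rewrite (inV _ ntC).
Qed.

Lemma simulator_parameters : scm_params simulator 3 1 4 3 3 0.
Proof.
split.
- by move=> r /simulator_matrixP [->|[]].
- apply: leq_trans (size_undup _) _; rewrite size_filter count_cat.
  have -> : count (fun a => a \notin T) T = 0.
    by apply/eqP; rewrite -leqn0 leqNgt -has_count; apply/hasPn => a aT; rewrite negbK.
  by rewrite addn0; apply: leq_trans (count_size _ _) _.
(* The families [m_read] and [m_push], whose sizes depend on [G], are unconditional. Only [m_mark],
   [m_match] and [m_stop] are counted. *)
- rewrite !count_cat !count_map /=.
  by rewrite (eq_count (a2 := pred0)) // count_pred0 (eq_count (a2 := pred0)) // count_pred0.
- by move=> r /simulator_matrixP [->|[]].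
- rewrite !count_cat !count_map /=.
  by rewrite (eq_count (a2 := pred0)) // count_pred0 (eq_count (a2 := pred0)) // count_pred0.
Qed.

End Simulation.

Theorem psg_in_SSCM (G : psgrammar) : psg_wf G ->
  in_SSCM 3 1 4 3 3 (psg_lang G).
Proof.
move=> Gwf; exists (simulator G); split; first exact: simulator_wf.
split; first exact: simulator_parameters.
move=> w; split=> -[wT h]; split=> //; first exact: simulator_complete.
exact: simulator_sound h.
Qed.

(** * Simulation of a simple matrix grammar by a phrase structure grammar *)

Lemma In_flatten_map (T U : Type) (f : T -> seq U) y s :
  List.In y (flatten (map f s)) <-> exists2 x, List.In x s & List.In y (f x).
Proof.
elim: s => [|a s IH] /=; first by split=> // -[].
rewrite In_cat IH; split.
  by case=> [ya|[x xs yx]]; [exists a | exists x]; auto.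
by case=> x [->|xs] yx; [left | right; exists x].
Qed.

Lemma count_In (T : Type) (P : pred T) s x : count P s = 0 -> List.In x s -> ~~ P x.
Proof.
elim: s => //= a s IH /eqP; rewrite addn_eq0 => /andP [Pa /eqP Ps] [<-|]; last exact: IH.
by case: (P a) Pa.
Qed.

Lemma nseq_del (T : eqType) (a : T) u v n :
  u ++ a :: v = nseq n a -> u ++ v = nseq n.-1 a.
Proof.
move=> E; have := congr1 size E; rewrite size_cat size_nseq /= => <-.
have : all (pred1 a) (u ++ a :: v) by rewrite E all_nseq /= eqxx orbT.
rewrite all_cat /= => /and3P [au _ av].
have /all_pred1P -> : all (pred1 a) (u ++ v) by rewrite all_cat au.
by rewrite size_cat addnS.
Qed.

Lemma edge_del (T : eqType) (a : T) u v m n1 n2 : a \notin m ->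
  u ++ a :: v = nseq n1 a ++ m ++ nseq n2 a ->
  exists k1 k2, u ++ v = nseq k1 a ++ m ++ nseq k2 a.
Proof.
move=> am E; have [[p [/esym Ep ->]]|[q [Eq ->]]] := cat_cons_split E.
  by exists n1.-1, n2; rewrite catA (nseq_del Ep).
have [[p [Ep _]]|[q' [/esym Eq' ->]]] := cat_cons_split (esym Eq).
  by rewrite Ep mem_cat mem_head orbT in am.
by exists n1, n2.-1; rewrite -(nseq_del Eq') -!catA.
Qed.

Lemma prefix_nseq (T : eqType) (a : T) u v y n : a \notin u ->
  u ++ v = y ++ nseq n a -> exists2 y', y = u ++ y' & v = y' ++ nseq n a.
Proof.
elim: u y => [|c u IH] [|d y] /=.
- by move=> _ ->; exists [::].
- by move=> _ ->; exists (d :: y).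
- by case: n {IH} => //= n; rewrite inE negb_or => /andP [/eqP ac _] [/esym].
- rewrite inE negb_or => /andP [_ au] [-> /(IH _ au) [y' -> ->]].
  by exists y'.
Qed.

Lemma rcons_nseq (T : eqType) (a c : T) u x n : a != c ->
  u ++ [:: c] = nseq n a ++ x -> exists2 x', x = x' ++ [:: c] & u = nseq n a ++ x'.
Proof.
move=> ac; case/lastP: x => [|x d].
  rewrite cats0 => E; have : all (pred1 a) (u ++ [:: c]).
    by rewrite E all_nseq /= eqxx orbT.
  by rewrite all_cat /= eq_sym (negbTE ac) andbF.
by rewrite !cats1 -rcons_cat => /rcons_inj [-> ->]; exists x; rewrite ?cats1.
Qed.

Lemma infix1 (T : eqType) (a : T) s : infix [:: a] s = (a \in s).
Proof.
apply/infixP/idP => [[u [v ->]]|/path.splitPr [u v]].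
  by rewrite mem_cat mem_head orbT.
by exists u, v.
Qed.

(** * Symbols, states and productions of the phrase structure grammar *)

Section FromSCM.

Variable G : scm_grammar.
Hypothesis Gwf : scm_wf G.
Hypothesis Gsimple : forall r, List.In r (gM G) -> is_simple r.
Hypothesis Gforb : forall r, List.In r (gM G) -> cond_len (mforb r) <= 1.

Let V := gV G.
Notation ruleseq := (seq (nat * seq nat)).
Notation reaches := (star (scm_step G)).

Definition start_symbol := fresh V.
Definition edge := (fresh V).+1.
(** A head is a single letter, so its state is packed into a number by [pickle]. Heads lie above
    [edge], which lies above [V], so one comparison recognizes them. *)
Definition head_symbol (scan : option nat) (rs : ruleseq) :=
  (fresh V).+2 + pickle (scan, rs).
Definition rewriter := head_symbol None.
Definition scanner f := head_symbol (Some f).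

Lemma V_lt a : a \in V -> a < fresh V.
Proof. exact: fresh_gt. Qed.

Lemma head_gt o rs : edge < head_symbol o rs.
Proof. by rewrite /edge /head_symbol; lia. Qed.

Lemma head_inj o rs o' rs' :
  head_symbol o rs = head_symbol o' rs' -> o = o' /\ rs = rs'.
Proof. by move/addnI/(pcan_inj pickleK) => [-> ->]. Qed.

Lemma symbol_neq : ((forall o rs, (head_symbol o rs == edge) = false)
  * (start_symbol == edge = false)
  * (forall o rs, (head_symbol o rs == start_symbol) = false)
  * (edge == start_symbol = false)
  * (forall a, a \in V -> (a == edge) = false))%type.
Proof.
do !split.
- by move=> o rs; have := head_gt o rs; lia.
- by rewrite /edge /start_symbol; lia.
- by move=> o rs; have := head_gt o rs; rewrite /start_symbol /edge; lia.
- by rewrite /edge /start_symbol; lia.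
- by move=> a /V_lt; rewrite /edge; lia.
Qed.

Lemma symbol_ge : ((forall o rs, fresh V <= head_symbol o rs)
  * (fresh V <= edge) * (fresh V <= start_symbol))%type.
Proof.
rewrite /edge /start_symbol; do !split=> *; last by [].
- by rewrite /head_symbol; lia.
- by lia.
Qed.

Lemma edge_gt a : a \in V -> (a < edge) * ~~ (edge < a).
Proof. by move/V_lt; rewrite /edge => h; split; lia. Qed.

Opaque start_symbol edge head_symbol.

Fixpoint suffixes (rs : ruleseq) :=
  rs :: (if rs is _ :: rs' then suffixes rs' else [::]).

(** The empty list is the idle state between two matrices. Suffixes suffice because rules are
    consumed from the front, and they keep the set of productions finite. *)
Definition states : seq ruleseq :=
  [::] :: flatten [seq suffixes (mrules r) | r <- gM G].

(** A required factor is tested by one production that has it to the right of the head; an absent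
    condition counts as the empty factor. A forbidden letter is tested by a scanner that must travel
    from the left marker to the right one without meeting it. The default 0 is never taken, since
    the condition is nonempty. *)
Definition test_productions r : pairs :=
  match mforb r with
  | None => [:: (rewriter [::] :: odflt [::] (mperm r),
                 rewriter (mrules r) :: odflt [::] (mperm r))]
  | Some f => let h := scanner (head 0 f) (mrules r) in
      [:: ([:: edge; rewriter [::]], [:: edge; h]),
          ([:: h; edge], [:: rewriter (mrules r); edge])
        & [seq ([:: h; a], [:: a; h]) | a <- V & a != head 0 f]]
  end.

Definition apply_productions (rs : ruleseq) : pairs :=
  if rs is (A, x) :: rs' then [:: ([:: rewriter rs; A], rewriter rs' :: x)] else [::].

Definition productions : pairs :=
  [:: ([:: start_symbol], [:: edge; rewriter [::]; gS G; edge]);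
      ([:: rewriter [::]], [::]); ([:: edge], [::])]
  ++ flatten [seq [seq ([:: rewriter rs; a], [:: a; rewriter rs]) | a <- V] | rs <- states]
  ++ flatten [seq [seq ([:: a; rewriter rs], [:: rewriter rs; a]) | a <- V] | rs <- states]
  ++ flatten [seq apply_productions rs | rs <- states]
  ++ flatten [seq test_productions r | r <- gM G].

Inductive production : seq nat * seq nat -> Prop :=
| Prod_start : production ([:: start_symbol], [:: edge; rewriter [::]; gS G; edge])
| Prod_halt : production ([:: rewriter [::]], [::])
(* A marker may be lost at any time: this only disables later scans. *)
| Prod_edge : production ([:: edge], [::])
| Prod_right rs a of rs \in states & a \in V :
    production ([:: rewriter rs; a], [:: a; rewriter rs])
| Prod_left rs a of rs \in states & a \in V :
    production ([:: a; rewriter rs], [:: rewriter rs; a])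
| Prod_apply A x rs of (A, x) :: rs \in states :
    production ([:: rewriter ((A, x) :: rs); A], rewriter rs :: x)
| Prod_permit r of List.In r (gM G) & mforb r = None :
    production (rewriter [::] :: odflt [::] (mperm r),
                rewriter (mrules r) :: odflt [::] (mperm r))
| Prod_scan r f of List.In r (gM G) & mforb r = Some [:: f] :
    production ([:: edge; rewriter [::]], [:: edge; scanner f (mrules r)])
| Prod_pass r f a of List.In r (gM G) & mforb r = Some [:: f] & a \in V & a != f :
    production ([:: scanner f (mrules r); a], [:: a; scanner f (mrules r)])
| Prod_done r f of List.In r (gM G) & mforb r = Some [:: f] :
    production ([:: scanner f (mrules r); edge], [:: rewriter (mrules r); edge]).

Lemma forb_singleton r f : List.In r (gM G) -> mforb r = Some f ->
  f = [:: head 0 f] /\ mperm r = None.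
Proof.
move=> Gr Ef; case: Gwf => _ _ _ /(_ r Gr) [_ _ _]; rewrite Ef /= => /andP [f0 _].
have := Gforb Gr; have := Gsimple Gr; rewrite /is_simple Ef orbF /= => /eqP ->.
by case: f f0 {Ef} => [|a []].
Qed.

Lemma productionP p : List.In p productions <-> production p.
Proof.
(* [st] keeps [In_cat] from unfolding [states]. *)
have [st Est] : exists st, st = states by exists states.
have in_st rs : List.In rs st <-> rs \in states by rewrite Est; apply: In_mem.
rewrite /productions -Est !In_cat; split.
  case; first by case=> [<-|[<-|[<-|[]]]]; constructor.
  case; first by move=> H; case: (proj1 (In_flatten_map _ _ _) H) => rs /in_st ? /In_map [a /In_mem ? ->]; constructor.
  case; first by move=> H; case: (proj1 (In_flatten_map _ _ _) H) => rs /in_st ? /In_map [a /In_mem ? ->]; constructor.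
  case.
    by move=> H; case: (proj1 (In_flatten_map _ _ _) H) => -[|[A x] rs] /in_st ? //= [<-|[]]; constructor.
  move=> H; case: (proj1 (In_flatten_map _ _ _) H) => r Gr; rewrite /test_productions.
  case Ef: (mforb r) => [f|] /=; last by case=> [<-|[]]; constructor.
  have [Ef1 _] := forb_singleton Gr Ef; rewrite Ef1 in Ef.
  case=> [<-|[<-|]]; [exact: Prod_scan | exact: Prod_done |].
  by case/In_map=> a /In_mem; rewrite mem_filter => /andP [? ?] ->; apply: Prod_pass.
have test r q : List.In r (gM G) -> List.In q (test_productions r) ->
    List.In q (flatten [seq test_productions r | r <- gM G]).
  by move=> Gr qr; apply/In_flatten_map; exists r.
case=> [|||rs a srs aV|rs a srs aV|A x rs srs|r Gr Er|r f Gr Er|r f a Gr Er aV af|r f Gr Er].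
- by left; left.
- by left; right; left.
- by left; do 2 right; left.
- right; left; apply/In_flatten_map; exists rs; first exact/in_st.
  by apply/In_map; exists a => //; apply/In_mem.
- do 2 right; left; apply/In_flatten_map; exists rs; first exact/in_st.
  by apply/In_map; exists a => //; apply/In_mem.
- do 3 right; left; apply/In_flatten_map; exists ((A, x) :: rs); first exact/in_st.
  by left.
- by do 4 right; apply: test Gr _; rewrite /test_productions Er; left.
- by do 4 right; apply: test Gr _; rewrite /test_productions Er; left.
- do 4 right; apply: test Gr _; rewrite /test_productions Er; do 2 right.
  by apply/In_map; exists a => //; apply/In_mem; rewrite mem_filter af.
- by do 4 right; apply: test Gr _; rewrite /test_productions Er; right; left.
Qed.

(** Collecting the nonterminals from the productions makes every symbol of a production legal by
    construction. *)
Definition to_psg := PSG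
  [seq a <- start_symbol :: flatten [seq p.1 ++ p.2 | p <- productions] | a \notin gT G]
  (gT G) productions start_symbol.

Lemma T_sub_V : {subset gT G <= V}.
Proof. by case: Gwf. Qed.

Lemma fresh_notin_T a : fresh V <= a -> a \notin gT G.
Proof. by move=> h; apply/negP => /T_sub_V /V_lt; lia. Qed.

Lemma to_psg_wf : psg_wf to_psg.
Proof.
split.
- by move=> a; rewrite mem_filter => /andP [].
- by rewrite mem_filter fresh_notin_T //= inE eqxx.
move=> p Pp.
have sym a : a \in p.1 ++ p.2 -> (a \in psN to_psg) || (a \in psT to_psg).
  move=> ap; rewrite mem_filter; case: (a \in gT G); rewrite ?orbT // andTb orbF inE.
  by apply/orP; right; apply/flattenP; exists (p.1 ++ p.2); first by apply/mapP; exists p => //; apply/In_mem.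
split.
(* Each left-hand side contains the start symbol, a marker or a head; all of these are at least
   [fresh V], hence not terminal. *)
- suff /hasP [a ap ha] : has (fun a => fresh V <= a) p.1.
    apply/hasP; exists a => //; have := sym a; rewrite mem_cat ap => /(_ isT).
    by rewrite (negbTE (fresh_notin_T ha)) orbF.
  by move/productionP: Pp; case=> *; rewrite /= !symbol_ge ?orbT.
- by apply/allP => a ap; apply: sym; rewrite mem_cat ap.
- by apply/allP => a ap; apply: sym; rewrite mem_cat ap orbT.
Qed.

(** * Soundness: closure of the states and an invariant of sentential forms *)

Lemma states_V rs : rs \in states ->
  all (fun p => (p.1 \in V) && all (mem V) p.2) rs.
Proof.
rewrite inE => /orP [/eqP-> //|/In_mem].
move=> H; case: (proj1 (In_flatten_map _ _ _) H) => r Gr /In_mem {H}.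
case: Gwf => _ _ _ /(_ r Gr) [_ + _ _].
elim: (mrules r) => [|p qs IH] /=; first by rewrite inE => _ /eqP ->.
case/andP=> /andP [/andP [pV _] xV] qsV; rewrite inE => /orP [/eqP ->|/(IH qsV) //].
rewrite /= pV [X in X && _]xV /=; apply/allP => q /(allP qsV) /andP [/andP [qV _] yV].
by rewrite qV.
Qed.

Lemma states_behead p rs : p :: rs \in states -> rs \in states.
Proof.
rewrite [in X in X -> _]inE => /orP [//|/In_mem H].
case: (proj1 (In_flatten_map _ _ _) H) => r Gr /In_mem {}H.
rewrite inE; apply/orP; right; apply/In_mem/In_flatten_map; exists r => //; apply/In_mem.
have self s : s \in suffixes s by case: s => *; rewrite mem_head.
elim: (mrules r) H => [|q qs IH] /=; rewrite !inE // => /orP [/eqP [_ ->]|/IH ->].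
  by rewrite self orbT.
by rewrite orbT.
Qed.

Lemma matrix_state r : List.In r (gM G) -> mrules r \in states.
Proof.
move=> Gr; rewrite inE; apply/orP; right; apply/In_mem/In_flatten_map.
by exists r => //; apply/In_mem; case: (mrules r) => *; rewrite mem_head.
Qed.

Lemma perm_V r : List.In r (gM G) -> {subset odflt [::] (mperm r) <= V}.
Proof.
move=> Gr; case: Gwf => _ _ _ /(_ r Gr) [_ _ + _].
by case: (mperm r) => //= P /andP [_ /allP].
Qed.

(* [x ++ y] is the current word, and the head stands between x and y. *)
Definition pending h x y :=
  (exists2 rs, h = rewriter rs &
     forall v, apply_rules rs (x ++ y) v -> reaches [:: gS G] v) \/
  (exists f rs, [/\ h = scanner f rs, f \notin x &
     f \notin x ++ y -> forall v, apply_rules rs (x ++ y) v -> reaches [:: gS G] v]).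

(** The invariant of all reachable forms. Runs of markers of arbitrary length allow for lost
    markers. [pending] looks ahead: every way to finish the stored rules must lead to a word
    reachable in [G], so choices made on the way need not be recorded. *)
Inductive config : seq nat -> Prop :=
| Config_start : config [:: start_symbol]
| Config_head m n o rs x y of {subset x <= V} & {subset y <= V} &
    pending (head_symbol o rs) x y :
    config (nseq m edge ++ x ++ head_symbol o rs :: y ++ nseq n edge)
| Config_halted m n z of {subset z <= V} & reaches [:: gS G] z :
    config (nseq m edge ++ z ++ nseq n edge).

Lemma edge_notin_V (u : seq nat) : {subset u <= V} -> edge \notin u.
Proof. by move=> uV; apply/negP => /uV /edge_gt []; rewrite ltnn. Qed.

Lemma head_notin_side (u : seq nat) n o rs : {subset u <= V} ->
  (head_symbol o rs \notin u) && (head_symbol o rs \notin nseq n edge).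
Proof.
move=> uV; apply/andP; split; last by rewrite mem_nseq symbol_neq andbF.
by apply/negP => /uV /V_lt; have := symbol_ge.1.1 o rs; lia.
Qed.

Lemma start_not_config_symbol s : config s -> s = [:: start_symbol] \/ start_symbol \notin s.
Proof.
have nV (u : seq nat) : {subset u <= V} -> start_symbol \notin u.
  by move=> uV; apply/negP => /uV /V_lt; rewrite ltnNge symbol_ge.
case=> [|m n o rs x y xV yV _|m n z zV _]; [by left | right | right].
- rewrite !(mem_cat, inE) !negb_or !mem_nseq (eq_sym start_symbol) !nV //.
  by rewrite symbol_neq (eq_sym start_symbol) symbol_neq !andbF.
- rewrite !mem_cat !negb_or !mem_nseq nV //.
  by rewrite (eq_sym start_symbol) symbol_neq !andbF.
Qed.

Lemma config_head_inv s o rs l r : config s -> s = l ++ head_symbol o rs :: r ->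
  exists m n x y, [/\ l = nseq m edge ++ x, r = y ++ nseq n edge,
    {subset x <= V}, {subset y <= V} & pending (head_symbol o rs) x y].
Proof.
case=> [|m n o' rs' x y xV yV P|m n z zV _].
- move=> E; have : head_symbol o rs \in l ++ head_symbol o rs :: r.
    by rewrite mem_cat mem_head orbT.
  by rewrite -E inE symbol_neq.
- move=> E; exists m, n, x, y.
  (* Only heads exceed [edge], so the form has exactly one letter with this property. *)
  have side (u : seq nat) k : {subset u <= V} -> ~~ has (fun a => edge < a) (u ++ nseq k edge).
    move=> uV; apply/hasPn => a; rewrite mem_cat => /orP [/uV /edge_gt [] //|].
    by rewrite mem_nseq => /andP [_ /eqP ->]; rewrite ltnn.
  have sidel : ~~ has (fun a => edge < a) (nseq m edge ++ x).
    by have := side x m xV; rewrite !has_cat orbC.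
  rewrite catA in E.
  have [-> -> ->] := cat_cons_uniq (P := fun a => edge < a) (head_gt _ _) (head_gt _ _)
    sidel (side y n yV) (esym E).
  by split.
- move=> E; have : head_symbol o rs \in l ++ head_symbol o rs :: r.
    by rewrite mem_cat mem_head orbT.
  rewrite -E !mem_cat (negbTE (proj2 (andP (head_notin_side m o rs zV)))).
  rewrite (negbTE (proj1 (andP (head_notin_side n o rs zV)))) /=.
  by rewrite (negbTE (proj2 (andP (head_notin_side n o rs zV)))).
Qed.

Lemma config_head_inv2 s o rs l (u r : seq nat) : {subset u <= V} -> config s ->
  s = l ++ head_symbol o rs :: u ++ r ->
  exists m n x y, [/\ l = nseq m edge ++ x, r = y ++ nseq n edge,
    {subset x <= V}, {subset y <= V} & pending (head_symbol o rs) x (u ++ y)].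
Proof.
move=> uV cs /(config_head_inv cs) [m [n [x [y [-> E xV yV P]]]]].
have [y' Ey Er] := prefix_nseq (edge_notin_V uV) E.
exists m, n, x, y'; split=> //; last by rewrite -Ey.
by move=> a ay; apply: yV; rewrite Ey mem_cat ay orbT.
Qed.

Lemma pending_rewriter rs x y : pending (rewriter rs) x y ->
  forall v, apply_rules rs (x ++ y) v -> reaches [:: gS G] v.
Proof.
by case=> [[qs /head_inj [_ <-]]|[f [qs [/head_inj []]]]].
Qed.

Lemma pending_scanner f rs x y : pending (scanner f rs) x y -> f \notin x /\
  (f \notin x ++ y -> forall v, apply_rules rs (x ++ y) v -> reaches [:: gS G] v).
Proof.
by case=> [[qs /head_inj []]|[g [qs [/head_inj [[<-] <-]]]]].
Qed.

Lemma reaches_matrix r z v : List.In r (gM G) -> mstep r z v ->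
  reaches [:: gS G] z -> reaches [:: gS G] v.
Proof. by move=> Gr zv Sz; apply: rt_trans Sz _; apply: rt_step; exists r. Qed.

Lemma sub_cat (u v : seq nat) : {subset u <= V} -> {subset v <= V} -> {subset u ++ v <= V}.
Proof. by move=> uV vV a; rewrite mem_cat => /orP [/uV|/vV]. Qed.

Lemma sub_seq1 a : a \in V -> {subset [:: a] <= V}.
Proof. by move=> aV b; rewrite inE => /eqP ->. Qed.

Lemma config_step s s' : config s -> psg_step to_psg s s' -> config s'.
Proof.
move=> cs [p [/productionP Pp [l [r [Es ->]]]]].
have sub0 : {subset ([::] : seq nat) <= V} by [].
case: Pp Es => [|||rs a srs aV|rs a srs aV|A x0 rs srs|q Gq Eq|q f Gq Eq|q f a Gq Eq aV af|q f Gq Eq] /= Es.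
- case: (start_not_config_symbol cs) => [E|]; last by rewrite Es mem_cat mem_head orbT.
  have [El Er] : l = [::] /\ r = [::].
    have := congr1 size E; rewrite Es size_cat /= addnS => -[/eqP].
    by rewrite addn_eq0 => /andP [/nilP -> /nilP ->].
  rewrite El Er; apply: (@Config_head 1 1 None [::] [::] [:: gS G]) => //.
    by case: Gwf => _ _ /andP [SV _] _; apply: sub_seq1.
  by left; exists [::] => // v /= <-; apply: rt_refl.
- have [m [n [x [y [-> -> xV yV /pending_rewriter P]]]]] := config_head_inv cs Es.
  rewrite -!catA [x ++ _]catA; apply: Config_halted; first exact: sub_cat.
  exact: P.
(* A marker is erased: it belongs to one of the two outer runs, because the middle part contains
   none. *)
- case: cs Es => [|m n o rs x y xV yV P|m n z zV Sz].
  + move=> E; have : edge \in l ++ edge :: r by rewrite mem_cat mem_head orbT.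
    by rewrite -E inE symbol_neq.
  + move=> E.
    have [||k1 [k2 ->]] := @edge_del _ edge l r (x ++ head_symbol o rs :: y) m n.
    * rewrite mem_cat inE !negb_or edge_notin_V // edge_notin_V // andbT /=.
      by rewrite eq_sym symbol_neq.
    * by rewrite -E -!catA.
    * by rewrite -catA; apply: Config_head.
  + move=> E; have [|k1 [k2 ->]] := edge_del _ (esym E); first exact: edge_notin_V.
    exact: Config_halted.
- have aV' := sub_seq1 aV.
  have [m [n [x [y [-> -> xV yV /pending_rewriter P]]]]] := config_head_inv2 aV' cs Es.
  rewrite (_ : _ ++ _ = nseq m edge ++ (x ++ [:: a]) ++ rewriter rs :: y ++ nseq n edge);
    last by rewrite -!catA.
  apply: Config_head => //; first exact: sub_cat.
  by left; exists rs => // v; rewrite -catA; apply: P.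
- have Es' : s = (l ++ [:: a]) ++ rewriter rs :: r by rewrite Es -catA.
  have [m [n [x [y [El -> xV yV /pending_rewriter P]]]]] := config_head_inv cs Es'.
  have [|x' Ex ->] := rcons_nseq _ El; first by rewrite eq_sym symbol_neq.
  rewrite -catA; apply: (@Config_head m n None rs x' (a :: y)).
  + by move=> b bx; apply: xV; rewrite Ex mem_cat bx.
  + by apply: (@sub_cat [:: a]) => //; apply: sub_seq1.
  + by left; exists rs => // v; move: (P v); rewrite Ex -catA.
- have /= /andP [/andP [AV x0V] _] := states_V srs.
  have [m [n [x [y [-> -> xV yV /pending_rewriter P]]]]] := config_head_inv2 (sub_seq1 AV) cs Es.
  rewrite -catA (_ : _ :: _ ++ _ = rewriter rs :: (x0 ++ y) ++ nseq n edge); last by rewrite -catA.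
  apply: Config_head => //; first by apply: sub_cat => //; apply/allP.
  left; exists rs => // v Hv; apply: P => /=; exists (x ++ x0 ++ y); split=> //.
  by exists x, y.
- have [m [n [x [y [-> -> xV yV /pending_rewriter P]]]]] := config_head_inv2 (perm_V Gq) cs Es.
  rewrite -catA (_ : _ :: _ ++ _ = rewriter (mrules q) :: (odflt [::] (mperm q) ++ y) ++ nseq n edge);
    last by rewrite -catA.
  apply: Config_head => //; first by apply: sub_cat => //; apply: perm_V.
  left; exists (mrules q) => // v Hv.
  (* In the idle state [apply_rules] is equality, so [P] says that the current word is itself
     reachable. *)
  apply: (reaches_matrix Gq) (P _ erefl); split=> //; last by rewrite Eq.
  by case: (mperm q) => // w; apply/infixP; exists x, y.
- have Es' : s = (l ++ [:: edge]) ++ rewriter [::] :: r by rewrite Es -catA.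
  have [m [n [x [y [El -> xV yV /pending_rewriter P]]]]] := config_head_inv cs Es'.
  (* The marker just before the head forces the scan to begin at the left end of the word. *)
  have x0 : x = [::].
    case/lastP: x xV El {P} => // x b xV; rewrite -rcons_cat cats1 => /rcons_inj [_ Eb].
    by have := edge_notin_V xV; rewrite mem_rcons Eb mem_head.
  rewrite (_ : _ ++ _ = nseq m edge ++ [::] ++ scanner f (mrules q) :: y ++ nseq n edge);
    last by move: El; rewrite x0 cats0 => <-; rewrite -catA.
  apply: Config_head => //; right; exists f, (mrules q); split=> // fy v Hv.
  apply: (reaches_matrix Gq) (P _ erefl); rewrite x0; split=> //.
  + by have [_ ->] := forb_singleton Gq Eq.
  + by rewrite Eq infix1.
- have [m [n [x [y [-> -> xV yV /pending_scanner [fx P]]]]]] := config_head_inv2 (sub_seq1 aV) cs Es.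
  rewrite (_ : _ ++ _ = nseq m edge ++ (x ++ [:: a]) ++ scanner f (mrules q) :: y ++ nseq n edge);
    last by rewrite -!catA.
  apply: Config_head => //; first by apply: sub_cat => //; apply: sub_seq1.
  right; exists f, (mrules q); split=> //; last by rewrite -catA.
  by rewrite mem_cat negb_or fx inE eq_sym.
- have [m [n [x [y [-> Er xV yV /pending_scanner [fx P]]]]]] := config_head_inv cs Es.
  (* The marker just after the head shows that the whole word has been scanned. *)
  have y0 : y = [::].
    case: y yV Er {P} => // b y yV Er; have /= Eb := congr1 (head 0) Er.
    by have := edge_notin_V yV; rewrite Eb mem_head.
  rewrite Er y0 -catA; apply: (@Config_head m n None (mrules q) x [::]) => //.
  by left; exists (mrules q) => // v; move: P; rewrite y0 cats0 => /(_ fx); apply.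
Qed.

Lemma to_psg_sound w : psg_lang to_psg w -> scm_lang G w.
Proof.
move=> [wT h]; split=> //.
have cw : config w.
  move: w h {wT}; apply: star_ind_right; first exact: Config_start.
  by move=> y z _ yz cy; apply: config_step cy yz.
(* A terminal word has no symbol from [fresh V] on, which leaves only a halted form without
   markers. *)
have small a : a \in w -> a < fresh V by move=> /(allP wT) /T_sub_V /V_lt.
case: cw small => [|m n o rs x y _ _ _|m n z zV Sz] small.
- by have := small _ (mem_head _ _); rewrite ltnNge symbol_ge.
- have := small (head_symbol o rs); rewrite !mem_cat mem_head !orbT => /(_ isT).
  by rewrite ltnNge symbol_ge.
- case: m small => [|m] small; last first.
    by have := small edge (mem_head _ _); rewrite ltnNge symbol_ge.
  case: n small => [|n] small; first by rewrite cats0.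
  by have := small edge; rewrite !mem_cat mem_head !orbT ltnNge symbol_ge => /(_ isT).
Qed.

(** * Completeness: the head carries out a derivation of the matrix grammar *)

Notation psg_reaches := (star (psg_step to_psg)).

Lemma psg_produce p l r : production p -> psg_reaches (l ++ p.1 ++ r) (l ++ p.2 ++ r).
Proof.
move=> /productionP Pp; apply: rt_step; exists p; split=> //; by exists l, r.
Qed.

Lemma head_right h l u r :
  (forall a, a \in u -> production ([:: h; a], [:: a; h])) ->
  psg_reaches (l ++ h :: u ++ r) (l ++ u ++ h :: r).
Proof.
elim: u l => [|a u IH] l hu; first exact: rt_refl.
apply: rt_trans (psg_produce l (u ++ r) (hu a (mem_head _ _))) _.
have := IH (l ++ [:: a]); rewrite -!catA; apply=> b bu.
by apply: hu; rewrite inE bu orbT.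
Qed.

Lemma rewriter_right rs l (u r : seq nat) : rs \in states -> {subset u <= V} ->
  psg_reaches (l ++ rewriter rs :: u ++ r) (l ++ u ++ rewriter rs :: r).
Proof. by move=> srs uV; apply: head_right => a /uV; apply: Prod_right. Qed.

Lemma rewriter_left rs l (u r : seq nat) : rs \in states -> {subset u <= V} ->
  psg_reaches (l ++ u ++ rewriter rs :: r) (l ++ rewriter rs :: u ++ r).
Proof.
move=> srs; elim/last_ind: u r => [|u a IH] r uV; first exact: rt_refl.
have aV : a \in V by apply: uV; rewrite mem_rcons mem_head.
rewrite !cat_rcons; apply: (@rt_trans _ _ _ (l ++ u ++ rewriter rs :: a :: r)).
  by have := psg_produce (l ++ u) r (Prod_left srs aV); rewrite /= -!catA.
by apply: IH => b bu; apply: uV; rewrite mem_rcons inE bu orbT.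
Qed.

(** For each rule the head moves right to the chosen letter, rewrites it and returns to the left
    end, ready for the next rule. *)
Lemma run_rules rs l (z v r : seq nat) : rs \in states -> {subset z <= V} -> apply_rules rs z v ->
  psg_reaches (l ++ rewriter rs :: z ++ r) (l ++ rewriter [::] :: v ++ r).
Proof.
elim: rs z => [|[A x] rs IH] z srs zV /=; first by move=> <-; apply: rt_refl.
case=> w [[u1 [u2 [Ez Ew]]] wv].
have /= /andP [/andP [AV xV] _] := states_V srs.
have u1V : {subset u1 <= V} by move=> a au; apply: zV; rewrite Ez mem_cat au.
have u2V : {subset u2 <= V} by move=> a au; apply: zV; rewrite Ez mem_cat inE au !orbT.
have srs' := states_behead srs.
rewrite Ez -catA; apply: rt_trans (rewriter_right _ _ srs u1V) _.
have := psg_produce (l ++ u1) (u2 ++ r) (Prod_apply srs); rewrite /= -!catA => st.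
apply: rt_trans st _; apply: rt_trans (rewriter_left _ _ srs' u1V) _.
have := IH w srs' _ wv; rewrite Ew -!catA; apply.
by apply: sub_cat => //; apply: sub_cat => //; apply/allP.
Qed.

Lemma scm_step_V (u v : seq nat) : scm_step G u v -> {subset u <= V} -> {subset v <= V}.
Proof.
move=> [r [Gr [_ _ uv]]]; have := states_V (matrix_state Gr).
elim: (mrules r) u uv => [|[A x] rs IH] u /=; first by move=> ->.
case=> w [[u1 [u2 [Eu Ew]]] wv] /andP [/andP [_ /allP xV] rsV] uV.
apply: IH wv rsV _; rewrite Ew; apply: sub_cat; last apply: sub_cat => //.
  by move=> a au; apply: uV; rewrite Eu mem_cat au.
by move=> a au; apply: uV; rewrite Eu mem_cat inE au !orbT.
Qed.

Lemma simulate_step (u v : seq nat) : scm_step G u v -> {subset u <= V} ->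
  psg_reaches (edge :: rewriter [::] :: u ++ [:: edge])
              (edge :: rewriter [::] :: v ++ [:: edge]).
Proof.
move=> [q [Gq [hP hF uv]]] uV; have sq := matrix_state Gq.
(* It remains to test the condition and load the rules of [q], with the head back at the left
   end. *)
apply: (rt_trans _ _ _ _ _ _ (run_rules [:: edge] [:: edge] sq uV uv)).
case Eq: (mforb q) hF => [f|] hF.
  have [Ef _] := forb_singleton Gq Eq; rewrite Ef in Eq hF.
  rewrite infix1 in hF; set f0 := head 0 f in Eq hF.
  apply: rt_trans (psg_produce [::] (u ++ [:: edge]) (Prod_scan Gq Eq)) _.
  apply: rt_trans (_ : psg_reaches _ ([:: edge] ++ u ++ scanner f0 (mrules q) :: [:: edge])) _.
    apply: (head_right [:: edge]) => a au; apply: Prod_pass => //; first exact: uV.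
    by apply: contraNneq hF => <-.
  apply: rt_trans (_ : psg_reaches _ ([:: edge] ++ u ++ rewriter (mrules q) :: [:: edge])) _.
    by have := psg_produce (edge :: u) [::] (Prod_done Gq Eq).
  exact: (rewriter_left [:: edge]).
have [a [b Eu]] : exists a b, u = a ++ odflt [::] (mperm q) ++ b.
  by case: (mperm q) hP => [w /infixP|_]; last by exists [::], u.
have aV : {subset a <= V} by move=> c ca; apply: uV; rewrite Eu mem_cat ca.
have s0 : [::] \in states by [].
rewrite Eu -!catA.
apply: rt_trans (rewriter_right [:: edge] _ s0 aV) _.
have := psg_produce (edge :: a) (b ++ [:: edge]) (Prod_permit Gq Eq).
rewrite /= => st; apply: rt_trans st _.
exact: (rewriter_left [:: edge]).
Qed.

Lemma to_psg_complete w : scm_lang G w -> psg_lang to_psg w.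
Proof.
move=> [wT h]; split=> //.
have [_ run] : {subset w <= V} /\
    psg_reaches [:: start_symbol] (edge :: rewriter [::] :: w ++ [:: edge]).
  move: w h {wT}; apply: star_ind_right.
    split; first by case: Gwf => _ _ /andP [SV _] _; apply: sub_seq1.
    exact: (psg_produce [::] [::] Prod_start).
  move=> y z _ yz [yV run]; split; first exact: scm_step_V yz yV.
  exact: rt_trans run (simulate_step yz yV).
apply: rt_trans run _.
apply: rt_trans (psg_produce [:: edge] (w ++ [:: edge]) Prod_halt) _.
apply: rt_trans (psg_produce [::] (w ++ [:: edge]) Prod_edge) _.
by have := psg_produce w [::] Prod_edge; rewrite /= !cats0.
Qed.

End FromSCM.

(** * The two inclusions *)

Lemma SSCM_degree1_RE (n m l i : nat) (L : seq nat -> Prop) :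
  in_SSCM i 1 n m l L -> is_RE L.
Proof.
move=> [G [Gwf [[deg _ _ _ simple] GL]]].
have Gsimple r : List.In r (gM G) -> is_simple r.
  move=> Gr; have s0 : count (fun r => ~~ is_simple r) (gM G) = 0 by lia.
  by have := count_In s0 Gr; rewrite negbK.
have Gforb r : List.In r (gM G) -> cond_len (mforb r) <= 1 by case/deg.
exists (to_psg G); split; first exact: to_psg_wf.
move=> w; rewrite GL; split; first exact: to_psg_complete.
exact: to_psg_sound.
Qed.

Theorem mainTheorem3 (L : seq nat -> Prop) :
  in_SSCM 3 1 4 3 3 L <-> is_RE L.
Proof.
split; first exact: SSCM_degree1_RE.
move=> [G [Gwf GL]]; have [G' [wf' [par GL']]] := psg_in_SSCM Gwf.
by exists G'; split=> //; split=> // w; rewrite GL.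
Qed.
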